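(* Let $R$ be an associative ring with unit, let $\mathcal{B}$ be a class of right $R$-modules, and assume that the class $\mathcal{GF}_{\mathcal{B}}(R)$ of Gorenstein $\mathcal{B}$-flat left $R$-modules is closed under extensions. Let $$\widehat{\mathcal{B}}:=\Big\{X\in\mathrm{Ch}(R^{op}) : X\simeq\bigoplus_{m\in\mathbb{Z}}D^m(B_m),\ B_m\in\mathcal{B}\Big\}.$$ Then $$\mathbf{GF}_{\widehat{\mathcal{B}}}(R)=\mathrm{Ch}(\mathcal{GF}_{\mathcal{B}}(R)),$$ i.e. the Gorenstein $\widehat{\mathcal{B}}$-flat complexes are exactly the complexes all of whose components are Gorenstein $\mathcal{B}$-flat modules. In particular, when $\mathcal{B}$ is the class of injective right $R$-modules, the Gorenstein flat complexes are exactly the complexes of Gorenstein flat modules.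
   Context: Complexes have differentials $\partial_m\colon X_m\to X_{m-1}$; $Z_m$ = cycles, $B_m(-)$ = boundaries; $\mathrm{Ch}(R)$ is the category of complexes of left $R$-modules. The $m$-th disk $D^m(M)$ is the complex with $M$ in degrees $m$ and $m-1$, identity differential between them, and $0$ elsewhere. For $X\in\mathrm{Ch}(R^{op})$, $Y\in\mathrm{Ch}(R)$, let $X\otimes^{\cdot}Y$ be the usual tensor product, $(X\otimes^{\cdot}Y)_m=\bigoplus_kX_k\otimes_RY_{m-k}$, differential $x\otimes y\mapsto\partial x\otimes y+(-1)^kx\otimes\partial y$ ($x\in X_k$); the modified tensor product $X\otimes Y$ has $(X\otimes Y)_m=(X\otimes^{\cdot}Y)_m/B_m(X\otimes^{\cdot}Y)$ and differential $x\otimes y\mapsto\partial x\otimes y$. A complex $F\in\mathrm{Ch}(R)$ is flat if $-\otimes F$ is exact (equivalently, $F$ is exact with flat cycles). A left module $M$ is Gorenstein $\mathcal{B}$-flat if $M=Z_0(F)$ for some exact complex $F$ of flat modules such that $B\otimes_RF$ is exact for all $B\in\mathcal{B}$. For a class $\mathbf{B}\subseteq\mathrm{Ch}(R^{op})$, $\mathbf{GF}_{\mathbf{B}}(R)$ is the class of Gorenstein $\mathbf{B}$-flat complexes: those $X=Z_0(F_\bullet)$ for some exact $F_\bullet\in\mathrm{Ch}(\mathrm{Ch}(R))$ with flat complexes as terms such that $B\otimes F_\bullet$ is exact for all $B\in\mathbf{B}$. Gorenstein flat modules (resp. complexes) are the case where $\mathcal{B}$ (resp. $\mathbf{B}$)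 is the class of all injective right $R$-modules (resp. injective complexes of right $R$-modules). For a class $\mathcal{X}$ of modules, $\mathrm{Ch}(\mathcal{X})$ is the class of complexes with components in $\mathcal{X}$. *)

(* Defs.v *)
From HB Require Import structures.
From mathcomp Require Import all_boot all_order all_algebra.
From mathcomp Require Import finmap mathcomp_extra boolp classical_sets functions.
From mathcomp Require Import cardinality fsbigop.

Set Implicit Arguments.
Unset Strict Implicit.
Unset Printing Implicit Defensive.

Import GRing.Theory.
Local Open Scope ring_scope.

(* Left R-modules are [lmodType R] and right R-modules are [lmodType R^c]:
   for [M : lmodType R^c] the element [r *: x] is x r.  Abelian groups are
   [lmodType int].  A class of modules is a predicate on [lmodType _]. *)

Section ModuleNotions.
Variable S : pzRingType.

Definition exact_at (U V W : lmodType S) (f : U -> V) (g : V -> W) : Prop :=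
  forall y : V, g y = 0 <-> exists x : U, f x = y.

Definition short_exact (U V W : lmodType S) (f : U -> V) (g : V -> W) : Prop :=
  [/\ injective f, exact_at f g & forall z : W, exists y : V, g y = z].

Definition isomorphic (U V : lmodType S) : Prop :=
  exists f : {linear U -> V}, bijective f.

Definition closed_under_extensions (P : lmodType S -> Prop) : Prop :=
  forall (U V W : lmodType S) (f : {linear U -> V}) (g : {linear V -> W}),
    short_exact f g -> P U -> P W -> P V.

Definition injective_module (I : lmodType S) : Prop :=
  forall (U V : lmodType S) (f : {linear U -> V}) (g : {linear U -> I}),
    injective f -> exists h : {linear V -> I}, forall x, h (f x) = g x.

End ModuleNotions.

Section Kernel.
Variables (S : pzRingType) (U V : lmodType S) (f : {linear U -> V}).

Definition ker_pred : {pred U} := [pred x | f x == 0].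

Fact ker_pred_closed : submod_closed ker_pred.
Proof.
split=> [|a x y]; rewrite !inE ?raddf0 // => /eqP fx /eqP fy.
by rewrite linearP fx fy scaler0 addr0.
Qed.

HB.instance Definition _ := GRing.isSubmodClosed.Build S U ker_pred
  ker_pred_closed.

Record kermod : Type := KerMod { ker_val :> U; _ : ker_val \in ker_pred }.

HB.instance Definition _ := [isSub for ker_val].
HB.instance Definition _ := [Choice of kermod by <:].
HB.instance Definition _ := [SubChoice_isSubLmodule of kermod by <:].

End Kernel.

Section Span.
Variables (S : pzRingType) (V : lmodType S) (P : V -> Prop).

Inductive span : V -> Prop :=
| Span0 : span 0
| SpanP a x y : P x -> span y -> span (a *: x + y).

Definition span_pred : {pred V} := [pred x | `[< span x >]].

Lemma span_add x y : span x -> span y -> span (x + y).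
Proof.
move=> sx sy; elim: sx => [|a u v Pu _ IH]; first by rewrite add0r.
by rewrite -addrA; apply: SpanP.
Qed.

Lemma span_scale a x : span x -> span (a *: x).
Proof.
elim=> [|b u v Pu _ IH]; first by rewrite scaler0; apply: Span0.
by rewrite scalerDr scalerA; apply: SpanP.
Qed.

Lemma span_gen x : P x -> span x.
Proof.
by move=> Px; rewrite -[x]addr0 -[x]scale1r; apply: SpanP => //; apply: Span0.
Qed.

Lemma span_predP x : reflect (span x) (x \in span_pred).
Proof. exact: asboolP. Qed.

Fact span_pred_closed : submod_closed span_pred.
Proof.
split=> [|a x y]; first by apply/span_predP; exact: Span0.
move=> /span_predP sx /span_predP sy; apply/span_predP/span_add => //.
exact: span_scale.
Qed.

HB.instance Definition _ := GRing.isSubmodClosed.Build S V span_pred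
  span_pred_closed.

End Span.

(* The quotient of V by the submodule spanned by P. *)
Section QuotientModule.
Variables (S : pzRingType) (V : lmodType S) (P : V -> Prop).
Local Open Scope quotient_scope.

Definition quotmod : Type := Quotient.quot (span_pred P).

HB.instance Definition _ := GRing.Zmodule.on quotmod.

Definition quot_pi (x : V) : quotmod :=
  \pi_(Quotient.quot (span_pred P)) x.

Lemma quot_piE x y : quot_pi x = quot_pi y <-> span P (x - y).
Proof.
split=> [/eqP|sxy].
  by rewrite -Quotient.idealrBE => /span_predP.
by apply/eqP; rewrite -Quotient.idealrBE; apply/span_predP.
Qed.

Definition quot_repr (q : quotmod) : V := repr (q : Quotient.quot (span_pred P)).

Lemma quot_reprK q : quot_pi (quot_repr q) = q.
Proof. exact: reprK. Qed.

Lemma quot_piD x y : quot_pi (x + y) = quot_pi x + quot_pi y.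
Proof. exact: raddfD. Qed.

Definition quot_scale (a : S) (q : quotmod) : quotmod :=
  quot_pi (a *: quot_repr q).

Lemma quot_scale_pi a x : quot_scale a (quot_pi x) = quot_pi (a *: x).
Proof.
apply/quot_piE; rewrite -scalerBr; apply: span_scale.
exact/quot_piE/quot_reprK.
Qed.

Fact quot_scaleA a b q : quot_scale a (quot_scale b q) = quot_scale (a * b) q.
Proof. by rewrite -[q]quot_reprK !quot_scale_pi scalerA. Qed.

Fact quot_scale1 : left_id 1 quot_scale.
Proof. by move=> q; rewrite -[q]quot_reprK quot_scale_pi scale1r. Qed.

Fact quot_scaleDr : right_distributive quot_scale +%R.
Proof.
move=> a p q; rewrite -[p]quot_reprK -[q]quot_reprK -quot_piD !quot_scale_pi.
by rewrite -quot_piD scalerDr.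
Qed.

Fact quot_scaleDl q : {morph quot_scale^~ q : a b / a + b}.
Proof.
move=> a b; rewrite -[q]quot_reprK !quot_scale_pi -quot_piD.
by rewrite scalerDl.
Qed.

HB.instance Definition _ := GRing.Zmodule_isLmodule.Build S quotmod
  quot_scaleA quot_scale1 quot_scaleDr quot_scaleDl.

Fact quot_pi_linear : linear quot_pi.
Proof. by move=> a x y; rewrite quot_piD -quot_scale_pi. Qed.

HB.instance Definition _ := GRing.isLinear.Build S V quotmod _ quot_pi
  quot_pi_linear.

Lemma quot_ind (Q : quotmod -> Prop) :
  (forall x, Q (quot_pi x)) -> forall q, Q q.
Proof. by move=> H q; rewrite -[q]quot_reprK. Qed.

Section Lift.
Variables (W : lmodType S) (f : {linear V -> W}).
Hypothesis fP : forall x, P x -> f x = 0.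

Lemma span_ker x : span P x -> f x = 0.
Proof.
by elim=> [|a u v Pu _ IH]; rewrite ?raddf0 // linearP fP // scaler0 add0r.
Qed.

Definition quot_lift of (forall x, P x -> f x = 0) :=
  fun q : quotmod => f (quot_repr q).

Lemma quot_lift_pi x : quot_lift fP (quot_pi x) = f x.
Proof.
apply/eqP; rewrite -subr_eq0 -raddfB; apply/eqP/span_ker.
exact/quot_piE/quot_reprK.
Qed.

Fact quot_lift_linear : linear (quot_lift fP).
Proof.
move=> a p q; rewrite -[p]quot_reprK -[q]quot_reprK -linearP !quot_lift_pi.
by rewrite linearP.
Qed.

HB.instance Definition _ := GRing.isLinear.Build S quotmod W _ (quot_lift fP)
  quot_lift_linear.
End Lift.

End QuotientModule.

Section DirectSum.
Variables (S : pzRingType) (I : choiceType).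

Section Family.
Variable A : I -> lmodType S.
Local Open Scope classical_set_scope.

Definition fin_supp (f : forall i, A i) : Prop :=
  finite_set [set i | f i <> 0].

Record dsum : Type := DSum { dsum_fun :> forall i, A i; _ : fin_supp dsum_fun }.

Lemma dsum_supp (u : dsum) : fin_supp u.
Proof. by case: u. Qed.

Lemma dsumP (u v : dsum) : (forall i, u i = v i) -> u = v.
Proof.
case: u v => [u fu] [v fv] /= uv; have {uv} E : u = v by apply: functional_extensionality_dep.
by case: _ / E fv => fv; rewrite (Prop_irrelevance fu fv).
Qed.

HB.instance Definition _ := gen_eqMixin dsum.
HB.instance Definition _ := gen_choiceMixin dsum.

Fact dsum0_supp : fin_supp (fun i => 0 : A i).
Proof. by rewrite /fin_supp (_ : [set i | _] = set0) // -subset0 => i /=. Qed.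

Fact dsum_lin_supp a (u v : dsum) : fin_supp (fun i => a *: u i + v i).
Proof.
apply: (@sub_finite_set _ _ ([set i | u i <> 0] `|` [set i | v i <> 0])).
  move=> i /= nz; apply: contrapT => /not_orP[/contrapT u0 /contrapT v0].
  by apply: nz; rewrite u0 v0 scaler0 addr0.
by rewrite finite_setU; split; apply: dsum_supp.
Qed.

Fact dsum_add_supp (u v : dsum) : fin_supp (fun i => u i + v i).
Proof.
have := dsum_lin_supp 1 u v; congr fin_supp.
by apply: functional_extensionality_dep => i; rewrite scale1r.
Qed.

Fact dsum_scale_supp a (u : dsum) : fin_supp (fun i => a *: u i).
Proof.
have := dsum_lin_supp a u (DSum dsum0_supp); congr fin_supp.
by apply: functional_extensionality_dep => i; rewrite addr0.
Qed.

Definition dsum0 := DSum dsum0_supp.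
Definition dsum_add u v := DSum (dsum_add_supp u v).
Definition dsum_scale a u := DSum (dsum_scale_supp a u).

Fact dsum_addA : associative dsum_add.
Proof. by move=> u v w; apply: dsumP => i /=; rewrite addrA. Qed.
Fact dsum_addC : commutative dsum_add.
Proof. by move=> u v; apply: dsumP => i /=; rewrite addrC. Qed.
Fact dsum_add0 : left_id dsum0 dsum_add.
Proof. by move=> u; apply: dsumP => i /=; rewrite add0r. Qed.
Fact dsum_addN : left_inverse dsum0 (dsum_scale (-1)) dsum_add.
Proof. by move=> u; apply: dsumP => i /=; rewrite scaleN1r addNr. Qed.

HB.instance Definition _ := GRing.isZmodule.Build dsum
  dsum_addA dsum_addC dsum_add0 dsum_addN.

Fact dsum_scaleA a b u : dsum_scale a (dsum_scale b u) = dsum_scale (a * b) u.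
Proof. by apply: dsumP => i /=; rewrite scalerA. Qed.
Fact dsum_scale1 : left_id 1 dsum_scale.
Proof. by move=> u; apply: dsumP => i /=; rewrite scale1r. Qed.
Fact dsum_scaleDr : right_distributive dsum_scale +%R.
Proof. by move=> a u v; apply: dsumP => i /=; rewrite scalerDr. Qed.
Fact dsum_scaleDl u : {morph dsum_scale^~ u : a b / a + b}.
Proof. by move=> a b; apply: dsumP => i /=; rewrite scalerDl. Qed.

HB.instance Definition _ := GRing.Zmodule_isLmodule.Build S dsum
  dsum_scaleA dsum_scale1 dsum_scaleDr dsum_scaleDl.

Lemma dsum0E i : (0 : dsum) i = 0. Proof. by []. Qed.
Lemma dsumDE (u v : dsum) i : (u + v) i = u i + v i. Proof. by []. Qed.
Lemma dsumZE a (u : dsum) i : (a *: u) i = a *: u i. Proof. by []. Qed.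

Section Injection.
Variable i : I.

Fact dsum_in_supp (x : A i) : fin_supp (dfwith (fun j => 0 : A j) i x).
Proof.
apply: (@sub_finite_set _ _ [set i]) => [j /= nz|]; last exact: finite_set1.
by apply: contrapT => /eqP ji; apply: nz; rewrite dfwithout // eq_sym.
Qed.

Definition dsum_in (x : A i) : dsum := DSum (dsum_in_supp x).

Fact dsum_in_linear : linear dsum_in.
Proof.
move=> a x y; apply: dsumP => j; rewrite dsumDE dsumZE /=.
have [<-|ne] := eqVneq i j; first by rewrite !dfwithin.
by rewrite !dfwithout // scaler0 addr0.
Qed.

HB.instance Definition _ := GRing.isLinear.Build S (A i) dsum _ dsum_in
  dsum_in_linear.
End Injection.

Section Lift.
Variables (W : lmodType S) (h : forall i, {linear A i -> W}).

Definition dsum_lift (u : dsum) : W := \sum_(i \in [set: I]) h i (u i).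

Lemma dsum_lift_widen (D : set I) (u : dsum) : finite_set D ->
  [set i | u i <> 0] `<=` D -> dsum_lift u = \sum_(i \in D) h i (u i).
Proof.
move=> fD uD; apply/esym/fsbig_widen => // i [_ /= nD].
rewrite (_ : u i = 0) ?raddf0 //.
by apply: contrapT => nz; apply/nD/uD.
Qed.

Fact dsum_lift_linear : linear dsum_lift.
Proof.
move=> a u v.
set D := [set i | u i <> 0] `|` [set i | v i <> 0].
have fD : finite_set D by rewrite finite_setU; split; apply: dsum_supp.
have uD : [set i | u i <> 0] `<=` D by move=> i; left.
have vD : [set i | v i <> 0] `<=` D by move=> i; right.
have wD : [set i | (a *: u + v) i <> 0] `<=` D.
  move=> i /= nz; apply: contrapT => /not_orP[/contrapT u0 /contrapT v0].
  by apply: nz; rewrite u0 v0 scaler0 addr0.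
rewrite !(dsum_lift_widen fD) // !fsbig_finite // scaler_sumr -big_split /=.
by apply: eq_bigr => i _; rewrite linearP.
Qed.

HB.instance Definition _ := GRing.isLinear.Build S dsum W _ dsum_lift
  dsum_lift_linear.

Lemma dsum_lift_in i x : dsum_lift (dsum_in x) = h i x.
Proof.
rewrite (@dsum_lift_widen [set i]) ?fsbig_set1 /= ?dfwithin //.
move=> j /= nz; apply: contrapT => /eqP ji.
by apply: nz; rewrite dfwithout // eq_sym.
Qed.
End Lift.

Lemma dsum_sum_in (u : dsum) :
  u = \sum_(i <- fset_set [set i | u i <> 0]) dsum_in (u i).
Proof.
have fE i : i \in fset_set [set i | u i <> 0] = (u i != 0).
  rewrite in_fset_set; last exact: dsum_supp.
  by apply/idP/idP; rewrite inE => /eqP.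
apply: dsumP => j.
have evE (s : seq I) (F : I -> dsum) : (\sum_(i <- s) F i) j = \sum_(i <- s) F i j.
  by elim: s => [|i s IH]; rewrite ?big_nil // !big_cons dsumDE IH.
rewrite evE; have [u0|nz] := eqVneq (u j) 0.
  rewrite u0 big_seq big1 // => i; rewrite fE => ui.
  by rewrite /= dfwithout //; apply: contraNneq ui => ->; apply/eqP.
rewrite (bigD1_seq j) ?fset_uniq ?fE //= dfwithin big1 ?addr0 // => i ij.
by rewrite dfwithout.
Qed.

Lemma dsum_ext (W : lmodType S) (f g : {linear dsum -> W}) :
  (forall i x, f (dsum_in (i := i) x) = g (dsum_in x)) -> forall u, f u = g u.
Proof.
by move=> fg u; rewrite [u]dsum_sum_in !linear_sum; apply: eq_bigr.
Qed.

End Family.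

Section Map.
Variables (A B : I -> lmodType S) (h : forall i, {linear A i -> B i}).
Local Open Scope classical_set_scope.

Fact dsum_map_supp (u : dsum A) : fin_supp (fun i => h i (u i)).
Proof.
apply: sub_finite_set (dsum_supp u) => i /= nz u0.
by apply: nz; rewrite u0 raddf0.
Qed.

Definition dsum_map (u : dsum A) : dsum B := DSum (dsum_map_supp u).

Fact dsum_map_linear : linear dsum_map.
Proof. by move=> a u v; apply: dsumP => i /=; rewrite linearP. Qed.

HB.instance Definition _ := GRing.isLinear.Build S (dsum A) (dsum B) _ dsum_map
  dsum_map_linear.

Lemma dsum_map_in i (x : A i) : dsum_map (dsum_in x) = dsum_in (h i x).
Proof.
apply: dsumP => j /=; have [<-|ne] := eqVneq i j; first by rewrite !dfwithin.
by rewrite !dfwithout // raddf0.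
Qed.
End Map.

End DirectSum.

Section ScaleBy.
Variables (V : lmodType int) (v : V).
Definition scale_by (n : int^o) : V := n *: v.
Fact scale_by_linear : linear scale_by.
Proof. by move=> a n p; rewrite /scale_by scalerDl scalerA. Qed.
HB.instance Definition _ := GRing.isLinear.Build int int^o V _ scale_by
  scale_by_linear.
End ScaleBy.

Section Tensor.
Variables (R : pzRingType) (M : lmodType R^c) (N : lmodType R).

(* The free abelian group on the set M x N. *)
Definition tens_free : lmodType int := dsum (fun _ : M * N => int^o : lmodType int).

Definition tens_gen (x : M) (y : N) : tens_free :=
  dsum_in (A := fun _ : M * N => int^o : lmodType int) (i := (x, y)) 1.

Inductive tens_rel : tens_free -> Prop :=
| TensDl x x' y : tens_rel (tens_gen (x + x') y - (tens_gen x y + tens_gen x' y))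
| TensDr x y y' : tens_rel (tens_gen x (y + y') - (tens_gen x y + tens_gen x y'))
| TensA x (r : R) y : tens_rel (tens_gen ((r : R^c) *: x) y - tens_gen x (r *: y)).

Definition tens : lmodType int := quotmod tens_rel.

Definition pure (x : M) (y : N) : tens := quot_pi tens_rel (tens_gen x y).

Lemma pureDl x x' y : pure (x + x') y = pure x y + pure x' y.
Proof. by rewrite -quot_piD; apply/quot_piE/span_gen/TensDl. Qed.

Lemma pureDr x y y' : pure x (y + y') = pure x y + pure x y'.
Proof. by rewrite -quot_piD; apply/quot_piE/span_gen/TensDr. Qed.

Lemma pureA x (r : R) y : pure ((r : R^c) *: x) y = pure x (r *: y).
Proof. by apply/quot_piE/span_gen/TensA. Qed.

Lemma pure0l y : pure 0 y = 0.
Proof. by apply: (addrI (pure 0 y)); rewrite -pureDl !addr0. Qed.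

Lemma pure0r x : pure x 0 = 0.
Proof. by apply: (addrI (pure x 0)); rewrite -pureDr !addr0. Qed.

Lemma tens_ext (W : lmodType int) (f g : {linear tens -> W}) :
  (forall x y, f (pure x y) = g (pure x y)) -> forall t, f t = g t.
Proof.
move=> fg; apply: quot_ind.
pose F : {linear tens_free -> W} := f \o quot_pi tens_rel.
pose G : {linear tens_free -> W} := g \o quot_pi tens_rel.
apply: (@dsum_ext _ _ _ _ F G) => -[x y] n.
rewrite -[n](mulr1 (n : int)) [_ * _](_ : _ = n *: (1 : int^o)) //.
by rewrite !linearZ; congr (_ *: _); apply: fg.
Qed.

Section Lift.
Variables (W : lmodType int) (b : M -> N -> W).
Hypothesis bDl : forall x x' y, b (x + x') y = b x y + b x' y.
Hypothesis bDr : forall x y y', b x (y + y') = b x y + b x y'.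
Hypothesis bA : forall x (r : R) y, b ((r : R^c) *: x) y = b x (r *: y).

Let free_lift : {linear tens_free -> W} :=
  dsum_lift (fun p : M * N => scale_by (b p.1 p.2) : {linear int^o -> W}).

Let free_lift_gen x y : free_lift (tens_gen x y) = b x y.
Proof. by rewrite /free_lift /= dsum_lift_in; exact: scale1r. Qed.

Let free_lift_rel t : tens_rel t -> free_lift t = 0.
Proof.
case=> [x x' y|x y y'|x r y]; apply/eqP; rewrite linearB subr_eq0; apply/eqP.
- by rewrite linearD !free_lift_gen bDl.
- by rewrite linearD !free_lift_gen bDr.
- by rewrite !free_lift_gen bA.
Qed.

Definition tens_lift : tens -> W := quot_lift free_lift_rel.

HB.instance Definition _ := GRing.Linear.on tens_lift.

Lemma tens_lift_pure x y : tens_lift (pure x y) = b x y.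
Proof. exact: etrans (quot_lift_pi free_lift_rel _) (free_lift_gen x y). Qed.
End Lift.

End Tensor.

Section TensorMap.
Variable R : pzRingType.

Section Map.
Variables (M M' : lmodType R^c) (N N' : lmodType R).
Variables (f : {linear M -> M'}) (g : {linear N -> N'}).

Fact tens_map_Dl x x' y :
  pure (f (x + x')) (g y) = pure (f x) (g y) + pure (f x') (g y).
Proof. by rewrite linearD pureDl. Qed.
Fact tens_map_Dr x y y' :
  pure (f x) (g (y + y')) = pure (f x) (g y) + pure (f x) (g y').
Proof. by rewrite linearD pureDr. Qed.
Fact tens_map_A x (r : R) y :
  pure (f ((r : R^c) *: x)) (g y) = pure (f x) (g (r *: y)).
Proof. by rewrite !linearZ pureA. Qed.

Definition tens_map : tens M N -> tens M' N' :=
  tens_lift tens_map_Dl tens_map_Dr tens_map_A.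

HB.instance Definition _ := GRing.Linear.on tens_map.

Lemma tens_map_pure x y : tens_map (pure x y) = pure (f x) (g y).
Proof. exact: tens_lift_pure. Qed.
End Map.

End TensorMap.

Record chain_complex (S : pzRingType) : Type := ChainComplex {
  ch_obj :> int -> lmodType S;
  ch_diff : forall m, {linear ch_obj m -> ch_obj (m - 1)};
  ch_diffK : forall m (x : ch_obj m), ch_diff (m - 1) (ch_diff m x) = 0
}.

Record chain_map (S : pzRingType) (X Y : chain_complex S) : Type := ChainMap {
  cm_fun :> forall m, {linear X m -> Y m};
  cm_comm : forall m (x : X m),
    cm_fun (m - 1) (ch_diff X m x) = ch_diff Y m (cm_fun m x)
}.

Section ComplexNotions.
Variable S : pzRingType.

Definition chain_id (X : chain_complex S) : chain_map X X :=
  @ChainMap S X X (fun m => idfun) (fun m x => erefl).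

Definition exact_complex (X : chain_complex S) : Prop :=
  forall m, exact_at (ch_diff X m) (ch_diff X (m - 1)).

Definition exact_at_cx (X Y Z : chain_complex S)
    (f : chain_map X Y) (g : chain_map Y Z) : Prop :=
  forall m, exact_at (f m) (g m).

Definition short_exact_cx (X Y Z : chain_complex S)
    (f : chain_map X Y) (g : chain_map Y Z) : Prop :=
  forall m, short_exact (f m) (g m).

Definition isomorphic_cx (X Y : chain_complex S) : Prop :=
  exists f : chain_map X Y, forall m, bijective (f m).

Definition injective_complex (I : chain_complex S) : Prop :=
  forall (X Y : chain_complex S) (f : chain_map X Y) (g : chain_map X I),
    (forall m, injective (f m)) ->
    exists h : chain_map Y I, forall m x, h m (f m x) = g m x.

(* The differential out of [X n] lands in [X (n - 1)], hence the cast along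
   [n - 1 = m]. *)
Definition boundary (X : chain_complex S) (m : int) (x : X m) : Prop :=
  exists (n : int) (e : n - 1 = m) (y : X n),
    ecast k (X k) e (ch_diff X n y) = x.

Definition cycles (X : chain_complex S) (m : int) : lmodType S :=
  kermod (ch_diff X m).

End ComplexNotions.

Section KernelComplex.
Variables (S : pzRingType) (X Y : chain_complex S) (f : chain_map X Y).

Fact ker_diff_subproof m (x : kermod (f m)) :
  ch_diff X m (val x) \in ker_pred (f (m - 1)).
Proof.
by rewrite inE cm_comm; have /eqP -> := valP x; rewrite raddf0.
Qed.

Definition ker_diff m (x : kermod (f m)) : kermod (f (m - 1)) :=
  KerMod (ker_diff_subproof x).

Fact ker_diff_linear m : linear (@ker_diff m).
Proof. by move=> a x y; apply: val_inj; rewrite /= linearP. Qed.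

HB.instance Definition _ m := GRing.isLinear.Build S (kermod (f m))
  (kermod (f (m - 1))) _ (@ker_diff m) (@ker_diff_linear m).

Fact ker_diffK m (x : kermod (f m)) : ker_diff (ker_diff x) = 0.
Proof. by apply: val_inj; rewrite /= ch_diffK. Qed.

Definition kercx : chain_complex S :=
  @ChainComplex S (fun m => kermod (f m)) (fun m => @ker_diff m) ker_diffK.

End KernelComplex.

Section DirectSumComplex.
Variables (S : pzRingType) (I : choiceType) (X : I -> chain_complex S).

Fact dsum_diffK m (u : dsum (fun i => X i m)) :
  dsum_map (fun i => ch_diff (X i) (m - 1))
    (dsum_map (fun i => ch_diff (X i) m) u) = 0.
Proof. by apply: dsumP => i /=; rewrite ch_diffK. Qed.

Definition dsumcx : chain_complex S :=
  @ChainComplex S (fun m => dsum (fun i => X i m))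
    (fun m => dsum_map (fun i => ch_diff (X i) m)) dsum_diffK.

End DirectSumComplex.

Section Disk.
Variables (S : pzRingType) (M : lmodType S).

Definition only_if (b : bool) : lmodType S :=
  if b then M else ('rV[S]_0 : lmodType S).

Definition only_in (b : bool) : {linear M -> only_if b} :=
  if b return {linear M -> only_if b} then idfun else \0.

Definition only_out (b : bool) : {linear only_if b -> M} :=
  if b return {linear only_if b -> M} then idfun else \0.

Variable m : int.

(* M in degrees m and m - 1; the differential out of degree m is the identity
   of M, as [only_in] and [only_out] are identities there. *)
Definition disk_obj (n : int) : lmodType S :=
  only_if ((n == m) || (n == m - 1)).

Definition disk_diff (n : int) : {linear disk_obj n -> disk_obj (n - 1)} :=
  let d : {linear disk_obj n -> disk_obj (n - 1)} := only_in _ \o only_out _ in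
  if n == m then d else \0.

Fact disk_diffK n (x : disk_obj n) : disk_diff (n - 1) (disk_diff n x) = 0.
Proof.
have disk_diff0 k : k != m -> disk_diff k = \0 by move=> km; rewrite /disk_diff ifN.
have [nm|nm] := boolP (n == m); last by rewrite (disk_diff0 n nm) raddf0.
rewrite (disk_diff0 (n - 1)) // (eqP nm) -subr_eq0 addrAC subrr.
by rewrite sub0r oppr_eq0.
Qed.

Definition disk : chain_complex S := ChainComplex disk_diffK.

End Disk.

Section ModuleTensorComplex.
Variables (R : pzRingType) (B : lmodType R^c) (F : chain_complex R).

Fact tens_cx_diffK m (t : tens B (F m)) :
  tens_map idfun (ch_diff F (m - 1)) (tens_map (idfun : {linear B -> B}) (ch_diff F m) t) = 0.
Proof.
pose h : {linear tens B (F m) -> tens B (F (m - 1 - 1))} :=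
  tens_map idfun (ch_diff F (m - 1)) \o tens_map idfun (ch_diff F m).
apply: (tens_ext (f := h) (g := \0)) => x y.
by rewrite /h /= !tens_map_pure ch_diffK pure0r.
Qed.

Definition tens_cx : chain_complex int :=
  @ChainComplex int (fun m => tens B (F m))
    (fun m => tens_map idfun (ch_diff F m)) tens_cx_diffK.

End ModuleTensorComplex.

(* The usual tensor product X (x). Y.  Its degree m part is the direct sum of
   the X_i (x) Y_j over the pairs (i, j) with i + j = m: indexing by pairs
   rather than by k with j = m - k keeps the differential free of casts. *)
Section TotalTensor.
Variable R : pzRingType.

Definition tot_idx (m : int) : choiceType := {p : int * int | p.1 + p.2 == m}.

Fact tot_idxl_subproof m (p : tot_idx m) :
  ((val p).1 - 1, (val p).2).1 + ((val p).1 - 1, (val p).2).2 == m - 1.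
Proof. by rewrite /= addrAC (eqP (valP p)). Qed.

Fact tot_idxr_subproof m (p : tot_idx m) :
  ((val p).1, (val p).2 - 1).1 + ((val p).1, (val p).2 - 1).2 == m - 1.
Proof. by rewrite /= addrA (eqP (valP p)). Qed.

Definition tot_idxl m (p : tot_idx m) : tot_idx (m - 1) :=
  exist _ ((val p).1 - 1, (val p).2) (tot_idxl_subproof p).

Definition tot_idxr m (p : tot_idx m) : tot_idx (m - 1) :=
  exist _ ((val p).1, (val p).2 - 1) (tot_idxr_subproof p).

Section Object.
Variables (X : chain_complex R^c) (Y : chain_complex R).

Definition tot_comp m (p : tot_idx m) : lmodType int :=
  tens (X (val p).1) (Y (val p).2).

Definition tot_obj m : lmodType int := dsum (@tot_comp m).

Definition tot_pure m (p : tot_idx m) (x : X (val p).1) (y : Y (val p).2) :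
  tot_obj m := dsum_in (A := @tot_comp m) (i := p) (pure x y).

Lemma tot_ext m (W : lmodType int) (f g : {linear tot_obj m -> W}) :
  (forall p x y, f (@tot_pure m p x y) = g (tot_pure x y)) ->
  forall t, f t = g t.
Proof.
move=> fg; apply: dsum_ext => p t.
pose F : {linear tot_comp p -> W} :=
  f \o (@dsum_in _ _ (@tot_comp m) p).
pose G : {linear tot_comp p -> W} :=
  g \o (@dsum_in _ _ (@tot_comp m) p).
by apply: (tens_ext (f := F) (g := G)) => x y; apply: fg.
Qed.

(* x (x) y |-> dx (x) y *)
Definition tot_dl_comp m (p : tot_idx m) : tot_comp p -> tot_obj (m - 1) :=
  dsum_in (A := @tot_comp (m - 1)) (i := tot_idxl p)
    \o tens_map (ch_diff X (val p).1) (idfun : {linear Y (val p).2 -> _}).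

HB.instance Definition _ m p := GRing.Linear.on (@tot_dl_comp m p).

(* x (x) y |-> x (x) dy *)
Definition tot_dr_comp m (p : tot_idx m) : tot_comp p -> tot_obj (m - 1) :=
  dsum_in (A := @tot_comp (m - 1)) (i := tot_idxr p)
    \o tens_map (idfun : {linear X (val p).1 -> _}) (ch_diff Y (val p).2).

HB.instance Definition _ m p := GRing.Linear.on (@tot_dr_comp m p).

Definition tot_diff_comp m (p : tot_idx m) (t : tot_comp p) : tot_obj (m - 1) :=
  tot_dl_comp t + (-1) ^ (val p).1 *: tot_dr_comp t.

Fact tot_diff_comp_linear m p : linear (@tot_diff_comp m p).
Proof.
move=> a t u; rewrite /tot_diff_comp !linearP !scalerDr addrACA.
congr (_ + (_ + _)); rewrite !scalerA; congr (_ *: _); exact: mulrC.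
Qed.

HB.instance Definition _ m p := GRing.isLinear.Build int (tot_comp p)
  (tot_obj (m - 1)) _ (@tot_diff_comp m p) (@tot_diff_comp_linear m p).

Definition tot_diff m : tot_obj m -> tot_obj (m - 1) :=
  dsum_lift (fun p => @tot_diff_comp m p).

HB.instance Definition _ m := GRing.Linear.on (@tot_diff m).

Definition tot_dl m : tot_obj m -> tot_obj (m - 1) :=
  dsum_lift (fun p => @tot_dl_comp m p).

HB.instance Definition _ m := GRing.Linear.on (@tot_dl m).

Lemma tot_dl_pure m (p : tot_idx m) (x : X (val p).1) (y : Y (val p).2) :
  tot_dl (tot_pure x y) = tot_pure (p := tot_idxl p) (ch_diff X _ x) y.
Proof.
by rewrite /tot_dl /= dsum_lift_in /= /tot_dl_comp /= tens_map_pure.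
Qed.

Lemma tot_diff_pure m (p : tot_idx m) (x : X (val p).1) (y : Y (val p).2) :
  tot_diff (tot_pure x y) =
    tot_pure (p := tot_idxl p) (ch_diff X _ x) y
    + (-1) ^ (val p).1 *: tot_pure (p := tot_idxr p) x (ch_diff Y _ y).
Proof.
rewrite /tot_diff /= dsum_lift_in /= /tot_diff_comp /tot_dl_comp /tot_dr_comp.
by rewrite /= !tens_map_pure.
Qed.

Lemma tot_pureC m (p : tot_idx m) (x : X ((val p).1 - 1)) (y : Y ((val p).2 - 1)) :
  tot_pure (p := tot_idxr (tot_idxl p)) x y =
  tot_pure (p := tot_idxl (tot_idxr p)) x y.
Proof.
rewrite /tot_pure /tot_idxl /tot_idxr /=.
set H1 := tot_idxr_subproof _; set H2 := tot_idxl_subproof _.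
by rewrite (bool_irrelevance H1 H2).
Qed.

Lemma sign_pred (i : int) : (-1) ^ (i - 1) = - (-1) ^ i :> int.
Proof. by rewrite exprzDr ?unitrN1 // [X in _ * X]exprN1 invrN1 mulrN1. Qed.

Lemma tot_diffK m (t : tot_obj m) : tot_diff (tot_diff t) = 0.
Proof.
pose h : {linear tot_obj m -> tot_obj (m - 1 - 1)} :=
  @tot_diff (m - 1) \o @tot_diff m.
apply: (tot_ext (f := h) (g := \0)) => p x y.
rewrite /h /= tot_diff_pure linearD linearZ /= !tot_diff_pure /=.
rewrite !ch_diffK /tot_pure pure0l pure0r !linear0 add0r addr0.
by rewrite sign_pred scaleNr -!/(tot_pure _ _) tot_pureC addNr.
Qed.

Lemma tot_dlK m (t : tot_obj m) : tot_dl (tot_dl t) = 0.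
Proof.
pose h : {linear tot_obj m -> tot_obj (m - 1 - 1)} :=
  @tot_dl (m - 1) \o @tot_dl m.
apply: (tot_ext (f := h) (g := \0)) => p x y.
by rewrite /h /= !tot_dl_pure ch_diffK /tot_pure pure0l linear0.
Qed.

Lemma tot_dl_diff m (t : tot_obj m) : tot_dl (tot_diff t) = - tot_diff (tot_dl t).
Proof.
pose h : {linear tot_obj m -> tot_obj (m - 1 - 1)} :=
  @tot_dl (m - 1) \o @tot_diff m.
pose k : {linear tot_obj m -> tot_obj (m - 1 - 1)} :=
  -%R \o (@tot_diff (m - 1) \o @tot_dl m).
apply: (tot_ext (f := h) (g := k)) => p x y.
rewrite /h /k /= tot_diff_pure linearD linearZ /= !tot_dl_pure tot_diff_pure /=.
rewrite !ch_diffK /tot_pure !pure0l !linear0 !add0r.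
by rewrite sign_pred scaleNr opprK -!/(tot_pure _ _) tot_pureC.
Qed.

Definition totcx : chain_complex int :=
  @ChainComplex int tot_obj (fun m => @tot_diff m) tot_diffK.

End Object.

End TotalTensor.

Section TotalTensorMap.
Variables (R : pzRingType) (X X' : chain_complex R^c) (Y Y' : chain_complex R).
Variables (f : chain_map X X') (g : chain_map Y Y').

Definition tot_map m : tot_obj X Y m -> tot_obj X' Y' m :=
  dsum_map (fun p : tot_idx m =>
    tens_map (f (val p).1) (g (val p).2) : {linear tot_comp X Y p -> tot_comp X' Y' p}).

HB.instance Definition _ m := GRing.Linear.on (@tot_map m).

Lemma tot_map_pure m (p : tot_idx m) (x : X (val p).1) (y : Y (val p).2) :
  tot_map (tot_pure x y) = tot_pure (f _ x) (g _ y).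
Proof. by rewrite /tot_map /tot_pure /= dsum_map_in /= tens_map_pure. Qed.

Lemma tot_map_diff m (t : tot_obj X Y m) :
  tot_map (tot_diff t) = tot_diff (tot_map t).
Proof.
pose h : {linear tot_obj X Y m -> tot_obj X' Y' (m - 1)} :=
  @tot_map (m - 1) \o @tot_diff R X Y m.
pose k : {linear tot_obj X Y m -> tot_obj X' Y' (m - 1)} :=
  @tot_diff R X' Y' m \o @tot_map m.
apply: (tot_ext (f := h) (g := k)) => p x y.
rewrite /h /k /= tot_diff_pure linearD linearZ /= !tot_map_pure tot_diff_pure /=.
by rewrite !cm_comm.
Qed.

Lemma tot_map_dl m (t : tot_obj X Y m) :
  tot_map (tot_dl t) = tot_dl (tot_map t).
Proof.
pose h : {linear tot_obj X Y m -> tot_obj X' Y' (m - 1)} :=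
  @tot_map (m - 1) \o @tot_dl R X Y m.
pose k : {linear tot_obj X Y m -> tot_obj X' Y' (m - 1)} :=
  @tot_dl R X' Y' m \o @tot_map m.
apply: (tot_ext (f := h) (g := k)) => p x y.
by rewrite /h /k /= tot_dl_pure !tot_map_pure tot_dl_pure /= cm_comm.
Qed.

End TotalTensorMap.

Lemma boundary_diff (S : pzRingType) (X : chain_complex S) m (x : X m) :
  boundary (ch_diff X m x).
Proof. by exists m, erefl, x. Qed.

(* The modified tensor product X (x) Y: in degree m the quotient of X (x). Y by
   its boundaries, which already form a submodule. *)
Section ModifiedTensor.
Variable R : pzRingType.

Section Object.
Variables (X : chain_complex R^c) (Y : chain_complex R).

Definition mtens_obj m : lmodType int :=
  quotmod (@boundary int (totcx X Y) m).

Definition mtens_pi m : tot_obj X Y m -> mtens_obj m :=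
  quot_pi (@boundary int (totcx X Y) m).

HB.instance Definition _ m := GRing.Linear.on (@mtens_pi m).

Definition mtens_pre m : tot_obj X Y m -> mtens_obj (m - 1) :=
  @mtens_pi (m - 1) \o @tot_dl R X Y m.

HB.instance Definition _ m := GRing.Linear.on (@mtens_pre m).

Lemma mtens_pi0 m (t : tot_obj X Y m) :
  @boundary int (totcx X Y) m t -> mtens_pi t = 0.
Proof.
move=> bt; rewrite -[RHS](linear0 (@mtens_pi m)).
by apply/quot_piE; rewrite subr0; apply: span_gen.
Qed.

Fact mtens_pre_boundary m (t : tot_obj X Y m) :
  @boundary int (totcx X Y) m t -> mtens_pre t = 0.
Proof.
case=> n [e [u]]; case: m / e t => t /= <-.
rewrite /mtens_pre /= tot_dl_diff linearN /= mtens_pi0 ?oppr0 //.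
exact: (@boundary_diff _ (totcx X Y)).
Qed.

(* x (x) y |-> dx (x) y *)
Definition mtens_diff m : mtens_obj m -> mtens_obj (m - 1) :=
  quot_lift (@mtens_pre_boundary m).

HB.instance Definition _ m := GRing.Linear.on (@mtens_diff m).

Lemma mtens_diff_pi m (t : tot_obj X Y m) :
  mtens_diff (mtens_pi t) = mtens_pi (tot_dl t).
Proof. exact: quot_lift_pi. Qed.

Fact mtens_diffK m (q : mtens_obj m) : mtens_diff (mtens_diff q) = 0.
Proof.
elim/quot_ind: q => t; rewrite -/(mtens_pi t) !mtens_diff_pi tot_dlK.
exact: linear0.
Qed.

Definition mtens : chain_complex int :=
  @ChainComplex int mtens_obj (fun m => @mtens_diff m) mtens_diffK.

End Object.

Section Map.
Variables (X X' : chain_complex R^c) (Y Y' : chain_complex R).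
Variables (f : chain_map X X') (g : chain_map Y Y').

Definition mtens_map_pre m : tot_obj X Y m -> mtens_obj X' Y' m :=
  @mtens_pi X' Y' m \o @tot_map R X X' Y Y' f g m.

HB.instance Definition _ m := GRing.Linear.on (@mtens_map_pre m).

Fact mtens_map_boundary m (t : tot_obj X Y m) :
  @boundary int (totcx X Y) m t -> mtens_map_pre t = 0.
Proof.
case=> n [e [u]]; case: m / e t => t /= <-.
rewrite /mtens_map_pre /= tot_map_diff mtens_pi0 //.
exact: (@boundary_diff _ (totcx X' Y')).
Qed.

Definition mtens_map_fun m : mtens_obj X Y m -> mtens_obj X' Y' m :=
  quot_lift (@mtens_map_boundary m).

HB.instance Definition _ m := GRing.Linear.on (@mtens_map_fun m).

Lemma mtens_map_pi m (t : tot_obj X Y m) :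
  mtens_map_fun (mtens_pi t) = mtens_pi (tot_map f g t).
Proof. exact: quot_lift_pi. Qed.

Fact mtens_map_comm m (q : mtens X Y m) :
  mtens_map_fun (mtens_diff q) = mtens_diff (mtens_map_fun q).
Proof.
elim/quot_ind: q => t; rewrite -/(mtens_pi t) mtens_diff_pi !mtens_map_pi.
by rewrite mtens_diff_pi tot_map_dl.
Qed.

Definition mtens_map : chain_map (mtens X Y) (mtens X' Y') :=
  @ChainMap int (mtens X Y) (mtens X' Y') (fun m => @mtens_map_fun m)
    mtens_map_comm.

End Map.

End ModifiedTensor.

Record complex_of_complexes (S : pzRingType) : Type := ComplexOfComplexes {
  cc_obj :> int -> chain_complex S;
  cc_diff : forall m, chain_map (cc_obj m) (cc_obj (m - 1));
  cc_diffK : forall m n (x : cc_obj m n),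
    cc_diff (m - 1) n (cc_diff m n x) = 0
}.

Definition exact_cc (S : pzRingType) (F : complex_of_complexes S) : Prop :=
  forall m, exact_at_cx (cc_diff F m) (cc_diff F (m - 1)).

Definition cycles_cc (S : pzRingType) (F : complex_of_complexes S) (m : int) :
  chain_complex S := kercx (cc_diff F m).

Section ModifiedTensorComplex.
Variables (R : pzRingType) (B : chain_complex R^c) (F : complex_of_complexes R).

Fact mtens_cc_diffK m n (q : mtens B (F m) n) :
  mtens_map (chain_id B) (cc_diff F (m - 1)) n
    (mtens_map (chain_id B) (cc_diff F m) n q) = 0.
Proof.
elim/quot_ind: q => t; rewrite -/(mtens_pi t) /= !mtens_map_pi.
pose h : {linear tot_obj B (F m) n -> tot_obj B (F (m - 1 - 1)) n} :=
  @tot_map _ _ _ _ _ (chain_id B) (cc_diff F (m - 1)) n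
  \o @tot_map _ _ _ _ _ (chain_id B) (cc_diff F m) n.
suff -> : tot_map (chain_id B) (cc_diff F (m - 1))
    (tot_map (chain_id B) (cc_diff F m) t) = 0 by exact: linear0.
apply: (tot_ext (f := h) (g := \0)) => p x y.
by rewrite /h /= !tot_map_pure /= cc_diffK /tot_pure pure0r linear0.
Qed.

Definition mtens_cc : complex_of_complexes int :=
  @ComplexOfComplexes int (fun m => mtens B (F m))
    (fun m => mtens_map (chain_id B) (cc_diff F m)) mtens_cc_diffK.

End ModifiedTensorComplex.

Section Gorenstein.
Variable R : pzRingType.

Definition flat_module (N : lmodType R) : Prop :=
  forall (U V W : lmodType R^c) (f : {linear U -> V}) (g : {linear V -> W}),
    short_exact f g ->
    short_exact (tens_map f (idfun : {linear N -> N}))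
                (tens_map g (idfun : {linear N -> N})).

Definition flat_complex (F : chain_complex R) : Prop :=
  forall (X Y Z : chain_complex R^c) (f : chain_map X Y) (g : chain_map Y Z),
    short_exact_cx f g ->
    short_exact_cx (mtens_map f (chain_id F)) (mtens_map g (chain_id F)).

Definition gorenstein_flat_module (BB : lmodType R^c -> Prop) (M : lmodType R) :
    Prop :=
  exists F : chain_complex R,
    [/\ exact_complex F,
        forall m, flat_module (F m),
        forall B : lmodType R^c, BB B -> exact_complex (tens_cx B F)
      & isomorphic M (cycles F 0)].

Definition gorenstein_flat_complex (BB : chain_complex R^c -> Prop)
    (X : chain_complex R) : Prop :=
  exists F : complex_of_complexes R,
    [/\ exact_cc F,
        forall m, flat_complex (F m),
        forall B : chain_complex R^c, BB B -> exact_cc (mtens_cc B F)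
      & isomorphic_cx X (cycles_cc F 0)].

Definition sums_of_disks (BB : lmodType R^c -> Prop) (X : chain_complex R^c) :
    Prop :=
  exists B : int -> lmodType R^c,
    (forall m, BB (B m)) /\ isomorphic_cx X (dsumcx (fun m => disk (B m) m)).

End Gorenstein.

(* Main.v *)
Require Import Defs.
From mathcomp Require Import all_boot all_order all_algebra.
Local Open Scope ring_scope.
From HB Require Import structures.
From mathcomp Require Import mathcomp_extra boolp classical_sets functions cardinality.
Import GRing.Theory.
Set Implicit Arguments.
Unset Strict Implicit.
Unset Printing Implicit Defensive.

(* Since D^0(M) (x) F is M (x) F_k in degree k, naturally in M and F, the terms
   of a flat complex are flat, and degree k of a Gorenstein flat resolution of X
   resolves X_k.  Conversely, a sum of disks P is contractible, so X (x). P is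
   exact and the modified tensor product embeds into it; hence P is a flat
   complex as soon as its terms are flat, and tensoring with sums of disks is
   exact as soon as tensoring with their terms is.  Given a complex X with
   Gorenstein flat terms, one step X_m -> F_m -> C_m of a resolution of each X_m
   yields a step X -> (+)_m D^(m+1)(F_m) -> Y, where Y_m is an extension of C_m by
   F_(m-1), hence Gorenstein flat; dually on the left.  Iterating in both
   directions and splicing resolves X.  An injective complex is a retract of the
   sum of disks on its terms, so the same argument applies to it. *)

(** * Linear maps, exactness and tensor products *)

Section LinearOf.
Variables (S : pzRingType) (U V : lmodType S) (f : U -> V).
(** An alias that remembers the proof of linearity, so that a function proved linear in the course
    of an argument becomes a linear map on the spot. *)
Definition lin_of of linear f := f.
Variable fl : linear f.
HB.instance Definition _ := GRing.isLinear.Build S U V _ (lin_of fl) fl.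
End LinearOf.

Section Exactness.
Variable S : pzRingType.

(** An element killed by [g] is moved to the primed row, lifted there along [f'], and its lift is
    brought back by [rU]. *)
Lemma exact_at_retract (U V W U' V' W' : lmodType S)
    (f : U -> V) (g : V -> W) (f' : U' -> V') (g' : V' -> W')
    (iV : V -> V') (iW : W -> W') (rU : U' -> U) (rV : V' -> V) :
    (forall u, g (f u) = 0) -> iW 0 = 0 ->
    (forall v, g' (iV v) = iW (g v)) -> (forall u, f (rU u) = rV (f' u)) ->
    cancel iV rV ->
  exact_at f' g' -> exact_at f g.
Proof.
move=> gf iW0 giV frU iVK ex v; split=> [gv|[u <-]]; last exact: gf.
have [u fu] : exists u, f' u = iV v by apply/ex; rewrite giV gv.
by exists (rU u); rewrite frU fu iVK.
Qed.

Lemma exact_at_comp0 (U V W : lmodType S) (f : U -> V) (g : V -> W) u :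
  exact_at f g -> g (f u) = 0.
Proof. by move=> ex; apply/ex; exists u. Qed.

Lemma short_exact_retract (U V W U' V' W' : lmodType S)
    (f : U -> V) (g : V -> W) (f' : U' -> V') (g' : V' -> W')
    (iU : U -> U') (iV : V -> V') (iW : W -> W')
    (rU : U' -> U) (rV : V' -> V) (rW : W' -> W) :
    iW 0 = 0 -> rW 0 = 0 ->
    (forall u, f' (iU u) = iV (f u)) -> (forall v, g' (iV v) = iW (g v)) ->
    (forall u, f (rU u) = rV (f' u)) -> (forall v, g (rV v) = rW (g' v)) ->
    cancel iU rU -> cancel iV rV -> cancel iW rW ->
  short_exact f' g' -> short_exact f g.
Proof.
move=> iW0 rW0 fi gi fr gr iUK iVK iWK [inj ex sur]; split=> [u v fuv||w].
- by apply: (can_inj iUK); apply: inj; rewrite !fi fuv.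
- apply: (exact_at_retract _ iW0 gi fr iVK ex) => u.
  by apply: (can_inj iWK); rewrite -gi -fi (exact_at_comp0 _ ex).
- by have [v gv] := sur (iW w); exists (rV v); rewrite gr gv iWK.
Qed.

Lemma linear_inj0 (U V : lmodType S) (f : {linear U -> V}) :
  (forall u, f u = 0 -> u = 0) -> injective f.
Proof. by move=> f0; apply: raddf_inj. Qed.

End Exactness.

Section TensorMaps.
Variable R : pzRingType.

Lemma tens_map_square (M M1 M2 M' : lmodType R^c) (N N1 N2 N' : lmodType R)
    (f1 : {linear M -> M1}) (f2 : {linear M1 -> M'})
    (k1 : {linear M -> M2}) (k2 : {linear M2 -> M'})
    (g1 : {linear N -> N1}) (g2 : {linear N1 -> N'})
    (l1 : {linear N -> N2}) (l2 : {linear N2 -> N'}) :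
    (forall x, f2 (f1 x) = k2 (k1 x)) -> (forall y, g2 (g1 y) = l2 (l1 y)) ->
  forall t, tens_map f2 g2 (tens_map f1 g1 t) = tens_map k2 l2 (tens_map k1 l1 t).
Proof.
move=> fk gl; pose a : {linear tens M N -> tens M' N'} := tens_map f2 g2 \o tens_map f1 g1.
pose b : {linear tens M N -> tens M' N'} := tens_map k2 l2 \o tens_map k1 l1.
apply: (tens_ext (f := a) (g := b)) => x y.
by rewrite /a /b /= !tens_map_pure fk gl.
Qed.

Lemma tens_map_id (M : lmodType R^c) (N : lmodType R)
    (f : {linear M -> M}) (g : {linear N -> N}) :
  (forall x, f x = x) -> (forall y, g y = y) -> forall t, tens_map f g t = t.
Proof.
move=> fE gE; apply: (tens_ext (f := tens_map f g) (g := idfun)) => x y.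
by rewrite /= tens_map_pure fE gE.
Qed.

Lemma tens_map0r (M M' : lmodType R^c) (N N' : lmodType R)
    (f : {linear M -> M'}) (g : {linear N -> N'}) :
  (forall y, g y = 0) -> forall t, tens_map f g t = 0.
Proof.
move=> gE; apply: (tens_ext (f := tens_map f g) (g := \0)) => x y.
by rewrite /= tens_map_pure gE pure0r.
Qed.

Lemma tens_map_comp (M M1 M' : lmodType R^c) (N N1 N' : lmodType R)
    (f1 : {linear M -> M1}) (f2 : {linear M1 -> M'}) (f : {linear M -> M'})
    (g1 : {linear N -> N1}) (g2 : {linear N1 -> N'}) (g : {linear N -> N'}) :
    (forall x, f2 (f1 x) = f x) -> (forall y, g2 (g1 y) = g y) ->
  forall t, tens_map f2 g2 (tens_map f1 g1 t) = tens_map f g t.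
Proof.
move=> fE gE; pose a : {linear tens M N -> tens M' N'} := tens_map f2 g2 \o tens_map f1 g1.
apply: (tens_ext (f := a) (g := tens_map f g)) => x y.
by rewrite /a /= !tens_map_pure fE gE.
Qed.

Lemma tens_ind (M : lmodType R^c) (N : lmodType R) (P : tens M N -> Prop) :
    (forall x y, P (pure x y)) -> P 0 -> (forall t u, P t -> P u -> P (t + u)) ->
    (forall t, P t -> P (- t)) ->
  forall t, P t.
Proof.
move=> Pp P0 PD PN; elim/quot_ind => u; rewrite [u]dsum_sum_in linear_sum /=.
apply: big_ind => // -[x y] _; set n := u _.
have -> : dsum_in n = n *: tens_gen x y.
  by rewrite -linearZ; congr dsum_in; rewrite /GRing.scale /= mulr1.
rewrite linearZ /= -/(pure x y).
(* Coefficients are integers, so the induction runs up and down from 0; the downward half needs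
   stability under opposites. *)
elim/int_rect: (n : int) => [|k IH|k IH]; first by rewrite scale0r.
- by rewrite intS scalerDl scale1r; apply: PD.
- by rewrite intS opprD scalerDl scaleN1r; apply: PD => //; apply: PN.
Qed.

Lemma tens_map_surj (M : lmodType R^c) (N N' : lmodType R)
    (g : {linear N -> N'}) :
    (forall y, exists x, g x = y) ->
  forall t, exists u, tens_map (idfun : {linear M -> M}) g u = t.
Proof.
move=> gs; elim/tens_ind => [x y||t u [t' <-] [u' <-]|t [t' <-]].
- by have [z <-] := gs y; exists (pure x z); rewrite tens_map_pure.
- by exists 0; rewrite linear0.
- by exists (t' + u'); rewrite linearD.
- by exists (- t'); rewrite linearN.
Qed.

End TensorMaps.

Section RightExactness.
Variables (R : pzRingType) (B : lmodType R^c) (U V W : lmodType R).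
Variables (f : {linear U -> V}) (g : {linear V -> W}).

(** The induced map from [B (x) V] modulo the image of [B (x) U] to [B (x) W] gets a left inverse:
    [x (x) w] goes to the class of [x (x) v] for any [v] over [w]. *)
Lemma tens_right_exact : exact_at f g -> (forall w, exists v, g v = w) ->
  exact_at (tens_map (idfun : {linear B -> B}) f)
           (tens_map (idfun : {linear B -> B}) g).
Proof.
move=> ex sur t; split=> [|[u <-]]; last first.
  pose gf : {linear U -> W} := g \o f.
  rewrite (@tens_map_comp _ _ _ _ _ _ _ idfun idfun idfun f g gf) //.
  by apply: tens_map0r => y; apply: exact_at_comp0 ex.
have [s gs] := choice sur.
pose P t := exists u, tens_map (idfun : {linear B -> B}) f u = t.
have PM x v : g v = 0 -> P (pure x v).
  by move=> /ex[u <-]; exists (pure x u); rewrite tens_map_pure.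
(* The chosen section [s] need not be additive; [bE] shows that the class is independent of the
   preimage, whence the bilinearity of [b]. *)
pose b x w : quotmod P := quot_pi P (pure x (s w)).
have bE x v : b x (g v) = quot_pi P (pure x v).
  apply/quot_piE/span_gen; have -> : pure x (s (g v)) - pure x v = pure x (s (g v) - v).
    by apply/eqP; rewrite subr_eq -pureDr subrK.
  by apply: PM; rewrite raddfB /= gs subrr.
have bDl x x' w : b (x + x') w = b x w + b x' w.
  by rewrite /b pureDl quot_piD.
have bDr x w w' : b x (w + w') = b x w + b x w'.
  by rewrite -{1}[w]gs -{1}[w']gs -raddfD bE pureDr quot_piD.
have bA x (r : R) w : b ((r : R^c) *: x) w = b x (r *: w).
  by rewrite -[w]gs -linearZ !bE pureA.
pose k : {linear tens B V -> quotmod P} :=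
  tens_lift bDl bDr bA \o tens_map (idfun : {linear B -> B}) g.
have kE : forall t, k t = quot_pi P t.
  apply: (tens_ext (f := k) (g := quot_pi P)) => x v.
  by rewrite /k /= tens_map_pure tens_lift_pure bE.
move=> gt0; have : quot_pi P t = quot_pi P 0.
  by rewrite -kE /k /= gt0 !linear0.
move/quot_piE; rewrite subr0; elim=> [|a x y [u <-] _ [v <-]].
  by exists 0; rewrite linear0.
by exists (a *: u + v); rewrite linearP.
Qed.

End RightExactness.

(** * Direct sums and their tensor products *)

Section DirectSums.
Variables (I : choiceType).

Lemma dsum_map_exact (S : pzRingType) (A B C : I -> lmodType S)
    (f : forall i, {linear A i -> B i}) (g : forall i, {linear B i -> C i}) :
  (forall i, exact_at (f i) (g i)) -> exact_at (dsum_map f) (dsum_map g).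
Proof.
move=> ex v; split=> [gv|[u <-]]; last first.
  by apply: dsumP => i /=; apply: exact_at_comp0 (ex i).
have H i : exists u, f i u = v i.
  by apply/ex; have := congr1 (fun w : dsum C => w i) gv.
pose u i := sval (cid (H i)); have fu i : f i (u i) = v i := svalP (cid (H i)).
(* Arbitrary preimages may have infinite support; they are replaced by 0 wherever [v] vanishes. *)
pose u' i := if v i == 0 then 0 else u i.
have fs : fin_supp u'.
  apply: sub_finite_set (dsum_supp v) => i; rewrite /= /u'.
  by case: eqP.
exists (DSum fs); apply: dsumP => i /=; rewrite /u'.
by case: eqP => [->|_]; rewrite ?linear0 ?fu.
Qed.

Lemma dsum_map_inj (S : pzRingType) (A B : I -> lmodType S)
    (f : forall i, {linear A i -> B i}) :
  (forall i, injective (f i)) -> injective (dsum_map f).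
Proof.
move=> inj u v fuv; apply: dsumP => i; apply: (inj i).
by have := congr1 (fun w : dsum B => w i) fuv.
Qed.

Lemma dsum_map_surj (S : pzRingType) (A B : I -> lmodType S)
    (f : forall i, {linear A i -> B i}) :
  (forall i y, exists x, f i x = y) -> forall v, exists u, dsum_map f u = v.
Proof.
(* Surjectivity is exactness in front of a zero map. *)
move=> sur v; have ex i : exact_at (f i) (\0 : {linear B i -> B i}).
  by move=> y; split=> // _; apply: sur.
by apply/(dsum_map_exact ex); apply: dsumP.
Qed.

Section Tensor.
Variables (R : pzRingType) (A : I -> lmodType R^c).

Section Retraction.
Variable N : lmodType R.

(** The comparison from [(+)_i A_i] tensored with [N] to the sum of the [A_i (x) N], on pure
    tensors; it is kept transparent so that its components compute. *)
Definition tens_split_pure (u : dsum A) (y : N) : dsum (fun i => tens (A i) N).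
Proof.
exists (fun i => pure (u i) y); apply: sub_finite_set (dsum_supp u) => i /= nz u0.
by apply: nz; rewrite u0 pure0l.
Defined.

Fact tens_split_Dl u u' y :
  tens_split_pure (u + u') y = tens_split_pure u y + tens_split_pure u' y.
Proof. by apply: dsumP => i; rewrite /= pureDl. Qed.
Fact tens_split_Dr u y y' :
  tens_split_pure u (y + y') = tens_split_pure u y + tens_split_pure u y'.
Proof. by apply: dsumP => i; rewrite /= pureDr. Qed.
Fact tens_split_A u (r : R) y :
  tens_split_pure ((r : R^c) *: u) y = tens_split_pure u (r *: y).
Proof. by apply: dsumP => i; rewrite /= pureA. Qed.

Definition tens_split : {linear tens (dsum A) N -> dsum (fun i => tens (A i) N)} :=
  tens_lift tens_split_Dl tens_split_Dr tens_split_A.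

Lemma tens_splitE u y i : tens_split (pure u y) i = pure (u i) y.
Proof. by rewrite /tens_split /= tens_lift_pure. Qed.

Definition tens_join : {linear dsum (fun i => tens (A i) N) -> tens (dsum A) N} :=
  dsum_lift (fun i => tens_map (dsum_in (A := A) (i := i)) (idfun : {linear N -> N})).

Lemma tens_splitK : cancel tens_split tens_join.
Proof.
move=> t; pose k : {linear tens (dsum A) N -> tens (dsum A) N} := tens_join \o tens_split.
suff: forall t, k t = (idfun : {linear tens (dsum A) N -> _}) t by apply.
apply: tens_ext => u y; change (tens_join (tens_split (pure u y)) = pure u y).
rewrite [u]dsum_sum_in.
elim/big_ind: _ => [|v w kv kw|i _].
- by rewrite pure0l !linear0.
- by rewrite pureDl !linearD kv kw.
have -> : tens_split (pure (dsum_in (u i)) y) =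
    dsum_in (A := fun i => tens (A i) N) (pure (u i) y).
  apply: dsumP => j; rewrite tens_splitE /=; have [<-|ne] := eqVneq i j.
    by rewrite !dfwithin.
  by rewrite !dfwithout // pure0l.
by rewrite /tens_join /= dsum_lift_in /= tens_map_pure.
Qed.

End Retraction.

Lemma tens_split_nat (N N' : lmodType R) (g : {linear N -> N'}) t :
  dsum_map (fun i => tens_map (idfun : {linear A i -> A i}) g) (tens_split _ t) =
  tens_split _ (tens_map (idfun : {linear dsum A -> _}) g t).
Proof.
elim/tens_ind: t => [u y||t t' IH IH'|t IH]; rewrite ?linear0 //.
- by apply: dsumP => i; rewrite tens_map_pure tens_splitE /= tens_splitE tens_map_pure.
- by rewrite !linearD /= IH IH'.
- by rewrite !linearN /= IH.
Qed.

Lemma tens_join_nat (N N' : lmodType R) (g : {linear N -> N'}) t :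
  tens_map (idfun : {linear dsum A -> _}) g (tens_join _ t) =
  tens_join _ (dsum_map (fun i => tens_map (idfun : {linear A i -> A i}) g) t).
Proof.
pose h := fun i => tens_map (idfun : {linear A i -> A i}) g.
pose k : {linear dsum (fun i => tens (A i) N) -> tens (dsum A) N'} :=
  tens_map (idfun : {linear dsum A -> _}) g \o @tens_join N.
pose l : {linear dsum (fun i => tens (A i) N) -> tens (dsum A) N'} :=
  @tens_join N' \o dsum_map h.
apply: (dsum_ext (f := k) (g := l)) => i x; rewrite /k /l /= /tens_join /=.
rewrite [dsum_map _ _]dsum_map_in !dsum_lift_in.
exact: tens_map_square.
Qed.

(* (+)_i A_i (x) - is a retract of (+)_i (A_i (x) -), so it preserves the
   exactness of every sequence preserved by all the A_i (x) -. *)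
Lemma tens_dsum_exact (U V W : lmodType R) (f : {linear U -> V})
    (g : {linear V -> W}) :
    (forall i, exact_at (tens_map (idfun : {linear A i -> A i}) f)
                        (tens_map (idfun : {linear A i -> A i}) g)) ->
  exact_at (tens_map (idfun : {linear dsum A -> _}) f)
           (tens_map (idfun : {linear dsum A -> _}) g).
Proof.
move=> ex; have dex := dsum_map_exact ex.
apply: (exact_at_retract _ _ (@tens_split_nat _ _ g) (@tens_join_nat _ _ f)
  (@tens_splitK V) dex); last exact: linear0.
move=> u; rewrite -[u](@tens_splitK U) !tens_join_nat.
by rewrite [dsum_map _ _](exact_at_comp0 _ dex) linear0.
Qed.

End Tensor.
End DirectSums.

(** * Families indexed by the integers *)

Section IntFamilies.

(** Builds a family from its values in degrees [m - 1]. The value at [m] is [f (m + 1)] transported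
    along [m + 1 - 1 = m]; equality proofs on integers being unique, the transport disappears in
    degree [m - 1]. *)
Lemma unpred (T : int -> Type) (f : forall m, T (m - 1)) :
  {t : forall m, T m | forall m, t (m - 1) = f m}.
Proof.
exists (fun m => ecast k (T k) (addrK 1 m) (f (m + 1))) => m.
suff H n (e : n - 1 = m - 1) (e' : n = m) : ecast k (T k) e (f n) = f m.
  by apply: H; exact: subrK.
by case: m / e' e => e; rewrite (eq_irrelevance e erefl).
Qed.

(** Dependent choice in both directions: [d] picks a successor, [u] a predecessor, and iterating
    either from [x] stays inside [P]. *)
Lemma int_chain (T : Type) (P : T -> Prop) (r : T -> T -> Prop) (x : T) :
    P x -> (forall y, P y -> exists2 z, P z & r y z) ->
    (forall y, P y -> exists2 z, P z & r z y) ->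
  exists2 z : int -> T, z 0 = x & forall m, P (z m) /\ r (z m) (z (m - 1)).
Proof.
move=> Px down up.
have [d dP] : exists d : T -> T, forall y, P y -> P (d y) /\ r y (d y).
  suff H y : exists z, P y -> P z /\ r y z.
    by exists (fun y => sval (cid (H y))) => y; exact: svalP (cid (H y)).
  (* Outside [P] any value will do; [y] itself is taken. *)
  have [Py|nPy] := pselect (P y); last by exists y.
  by have [z Pz yz] := down y Py; exists z.
have [u uP] : exists u : T -> T, forall y, P y -> P (u y) /\ r (u y) y.
  suff H y : exists z, P y -> P z /\ r z y.
    by exists (fun y => sval (cid (H y))) => y; exact: svalP (cid (H y)).
  have [Py|nPy] := pselect (P y); last by exists y.
  by have [z Pz yz] := up y Py; exists z.
(* [Negz n] stands for [-(n + 1)], hence the extra iteration of [d]. *)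
pose z (m : int) := match m with Posz n => iter n u x | Negz n => iter n.+1 d x end.
have Pz m : P (z m).
  case: m => n; rewrite /z; elim: n => [|n IH] //=.
  - by case: (uP _ IH).
  - by case: (dP _ Px).
  - by case: (dP _ IH).
exists z => // m; split=> //; case: m => [[|n]|n].
- by rewrite sub0r; case: (dP _ Px).
- have -> : n.+1%:Z - 1 = n by rewrite intS addrC addKr.
  by case: (uP _ (Pz (Posz n))).
- have -> : Negz n - 1 = Negz n.+1 by rewrite !NegzE -opprD [in RHS]intS addrC.
  by case: (dP _ (Pz (Negz n))).
Qed.

End IntFamilies.

(** * Contractible complexes and the modified tensor product *)

(** A null-homotopy of the identity, written in degree [m - 1] so that both composites land there
    without casts. *)
Definition contraction (S : pzRingType) (P : chain_complex S)
    (r : forall m : int, {linear P (m - 1) -> P m}) : Prop :=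
  forall (m : int) (x : P (m - 1)), ch_diff P m (r m x) + r (m - 1) (ch_diff P (m - 1) x) = x.

Lemma contraction_exact (S : pzRingType) (P : chain_complex S) r :
  @contraction S P r -> exact_complex P.
Proof.
move=> rP m y; split=> [dy|[x <-]]; last exact: ch_diffK.
by exists (r m y); have := rP m y; rewrite dy linear0 addr0.
Qed.

(** The homotopies below are given on summands indexed by [tot_idxl p] or [tot_idxr p]. These
    reindexings are bijections whose inverses would bring casts into every formula; here the cast is
    confined to the construction of [k]. *)
Lemma dsum_lift_along (S : pzRingType) (I J : choiceType) (phi : J -> I)
    (A : I -> lmodType S) (W : lmodType S) (h : forall j, {linear A (phi j) -> W}) :
    injective phi -> (forall i, exists j, phi j = i) ->
  {H : {linear dsum A -> W} |
    forall j x, H (dsum_in (A := A) (i := phi j) x) = h j x}.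
Proof.
move=> inj sur.
pose k i : {linear A i -> W} := let: exist j e := cid (sur i) in
  match e in _ = i' return {linear A i' -> W} with erefl => h j end.
exists (dsum_lift k) => j x; rewrite /= dsum_lift_in /k.
case: (cid _) => j' e; have jj' := inj _ _ e; subst j'.
by rewrite (eq_irrelevance e erefl).
Qed.

Section TotalHomotopies.

Lemma tot_idxl_bij m : injective (@tot_idxl m) /\ forall q, exists p, @tot_idxl m p = q.
Proof.
split=> [[[i j] p] [[i' j'] p'] /(congr1 val)[/addIr ii jj]|].
  by apply: val_inj; rewrite /= ii jj.
move=> [[i j] /= p]; have p' : (i + 1, j).1 + (i + 1, j).2 == m.
  by rewrite /= addrAC (eqP p) subrK.
by exists (exist _ (i + 1, j) p'); apply: val_inj; rewrite /= addrK.
Qed.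

Lemma tot_idxr_bij m : injective (@tot_idxr m) /\ forall q, exists p, @tot_idxr m p = q.
Proof.
split=> [[[i j] p] [[i' j'] p'] /(congr1 val)[ii /addIr jj]|].
  by apply: val_inj; rewrite /= ii jj.
move=> [[i j] /= p]; have p' : (i, j + 1).1 + (i, j + 1).2 == m.
  by rewrite /= addrA (eqP p) subrK.
by exists (exist _ (i, j + 1) p'); apply: val_inj; rewrite /= addrK.
Qed.

Variable R : pzRingType.

Lemma scale_linear (V W : lmodType int) (f : {linear V -> W}) (c : int) :
  linear (fun x => c *: f x).
Proof. by move=> a x y; rewrite linearP scalerDr !scalerA mulrC. Qed.

(* x (x) y |-> (-1)^i x (x) r y *)
Lemma tot_contractionr (X : chain_complex R^c) (P : chain_complex R) r :
  @contraction R P r -> exists h, @contraction int (totcx X P) h.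
Proof.
move=> rP.
pose h (m : int) := dsum_lift_along (phi := @tot_idxr m)
  (A := @tot_comp R X P (m - 1))
  (fun p : tot_idx m => lin_of (scale_linear (dsum_in (A := @tot_comp R X P m) (i := p)
     \o tens_map (idfun : {linear X (val p).1 -> _}) (r (val p).2)) ((-1) ^ (val p).1)) :
     {linear tot_comp X P (tot_idxr p) -> tot_obj X P m})
  (tot_idxr_bij m).1 (tot_idxr_bij m).2.
have hE m p x y : sval (h m) (tot_pure (p := tot_idxr p) x y) =
    (-1) ^ (val p).1 *: tot_pure (p := p) x (r _ y).
  rewrite (svalP (h m)) /lin_of /tot_pure; congr (_ *: dsum_in _).
  exact: tens_map_pure.
exists (fun m => sval (h m)) => m t.
pose k : {linear tot_obj X P (m - 1) -> tot_obj X P (m - 1)} :=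
  (@tot_diff R X P m \o sval (h m)) \+ (sval (h (m - 1)) \o @tot_diff R X P (m - 1)).
apply: (tot_ext (f := k) (g := idfun)) => q.
have [p <-] := (tot_idxr_bij m).2 q; move=> x y.
(* The two terms [dx (x) r y] carry the signs of degrees [i] and [i - 1] and cancel; the terms with
   [x] carry a squared sign and add up to [x (x) (d r + r d) y]. *)
rewrite /k /= tot_diff_pure hE linearD !linearZ /= -tot_pureC !hE /= tot_diff_pure.
rewrite scalerDr sign_pred scaleNr addrACA subrr add0r !scalerA.
have -> : (-1) ^ (val p).1 * (-1) ^ (val p).1 = 1 :> int.
  by rewrite -exprzMl ?unitrN1 // mulrNN mulr1 exp1rz.
rewrite !scale1r -[RHS](_ : tot_pure x (ch_diff P _ (r _ y) + r _ (ch_diff P _ y)) = _).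
  by rewrite /tot_pure pureDr linearD.
by rewrite rP.
Qed.

(* x (x) y |-> s x (x) y *)
Lemma tot_contractionl (B : chain_complex R^c) s : @contraction R^c B s ->
  exists h : forall (Y : chain_complex R) m, {linear tot_obj B Y (m - 1) -> tot_obj B Y m},
    (forall Y, @contraction int (totcx B Y) (h Y)) /\
    (forall Y Y' (g : chain_map Y Y') m t,
      h Y' m (tot_map (chain_id B) g t) = tot_map (chain_id B) g (h Y m t)).
Proof.
move=> sP.
pose h Y (m : int) := dsum_lift_along (phi := @tot_idxl m)
  (A := @tot_comp R B Y (m - 1))
  (fun p : tot_idx m => dsum_in (A := @tot_comp R B Y m) (i := p)
     \o tens_map (s (val p).1) (idfun : {linear Y (val p).2 -> _}) :
     {linear tot_comp B Y (tot_idxl p) -> tot_obj B Y m})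
  (tot_idxl_bij m).1 (tot_idxl_bij m).2.
have hE Y m p x y : sval (h Y m) (tot_pure (p := tot_idxl p) x y) =
    tot_pure (p := p) (s _ x) y.
  by rewrite (svalP (h Y m)) /= tens_map_pure.
exists (fun Y m => sval (h Y m)); split=> [Y m t|Y Y' g m t].
  pose k : {linear tot_obj B Y (m - 1) -> tot_obj B Y (m - 1)} :=
    (@tot_diff R B Y m \o sval (h Y m)) \+ (sval (h Y (m - 1)) \o @tot_diff R B Y (m - 1)).
  apply: (tot_ext (f := k) (g := idfun)) => q.
  have [p <-] := (tot_idxl_bij m).2 q; move=> x y.
  rewrite /k /= tot_diff_pure hE linearD !linearZ /= tot_pureC !hE /= tot_diff_pure.
  rewrite sign_pred scaleNr addrACA subrr addr0.
  rewrite -[RHS](_ : tot_pure (X := B) (p := tot_idxl p)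
      (ch_diff B _ (s _ x) + s _ (ch_diff B _ x)) y = _).
    by rewrite /tot_pure pureDl linearD.
  by rewrite sP.
pose k : {linear tot_obj B Y (m - 1) -> tot_obj B Y' m} :=
  sval (h Y' m) \o @tot_map _ _ _ _ _ (chain_id B) g (m - 1).
pose l : {linear tot_obj B Y (m - 1) -> tot_obj B Y' m} :=
  @tot_map _ _ _ _ _ (chain_id B) g m \o sval (h Y m).
apply: (tot_ext (f := k) (g := l)) => q.
have [p <-] := (tot_idxl_bij m).2 q; move=> x y.
by rewrite /k /l /= tot_map_pure hE hE tot_map_pure.
Qed.

End TotalHomotopies.

Section PairMaps.
Variables (S : pzRingType) (U V W : lmodType S).

Fact pair_map_subproof (f : {linear U -> V}) (g : {linear U -> W}) :
  linear (fun x => (f x, g x)).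
Proof. by move=> a x y; rewrite !linearP. Qed.

Definition pair_map (f : {linear U -> V}) (g : {linear U -> W}) :
  {linear U -> (V * W)%type} := lin_of (pair_map_subproof f g).

Fact fst_map_subproof : linear (fun x : V * W => x.1).
Proof. by []. Qed.
Fact snd_map_subproof : linear (fun x : V * W => x.2).
Proof. by []. Qed.

Definition fst_map : {linear (V * W)%type -> V} := lin_of fst_map_subproof.
Definition snd_map : {linear (V * W)%type -> W} := lin_of snd_map_subproof.

End PairMaps.
Arguments fst_map {S V W}.
Arguments snd_map {S V W}.

(** * Sums of disks on a family of modules *)

Section Cone.
Variable S : pzRingType.

(* The sum of the disks D^(m+1)(A m): for a family of modules A it is the
   contractible complex through which all families of maps into A factor. *)
Section Object.
Variable A : int -> lmodType S.

Definition cone_obj (m : int) : lmodType S := (A m * A (m - 1))%type.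

Definition cone_diff (m : int) : {linear cone_obj m -> cone_obj (m - 1)} :=
  pair_map snd_map \0.

Fact cone_diffK (m : int) (u : cone_obj m) : cone_diff (m - 1) (cone_diff m u) = 0.
Proof. by []. Qed.

Definition cone : chain_complex S := ChainComplex cone_diffK.

Definition cone_contraction (m : int) : {linear cone (m - 1) -> cone m} :=
  pair_map \0 fst_map.

Lemma cone_contractionP : contraction cone_contraction.
Proof.
move=> m [a b]; rewrite /= /cone_diff /cone_contraction /=.
by congr pair; rewrite /= ?addr0 ?add0r.
Qed.

End Object.

Section Map.
Variables (A A' : int -> lmodType S) (f : forall m : int, {linear A m -> A' m}).

Definition cone_map_fun (m : int) : {linear cone A m -> cone A' m} :=
  pair_map (f m \o fst_map) (f (m - 1) \o snd_map).

Fact cone_map_comm (m : int) (u : cone A m) :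
  cone_map_fun (m - 1) (ch_diff (cone A) m u) = ch_diff (cone A') m (cone_map_fun m u).
Proof. by congr pair; exact: linear0. Qed.

Definition cone_map : chain_map (cone A) (cone A') := ChainMap cone_map_comm.

End Map.

Lemma cone_short_exact (A A' A'' : int -> lmodType S)
    (f : forall m : int, {linear A m -> A' m})
    (g : forall m : int, {linear A' m -> A'' m}) :
    (forall m, short_exact (f m) (g m)) ->
  short_exact_cx (cone_map f) (cone_map g).
Proof.
move=> ex m; have [i1 e1 s1] := ex m; have [i2 e2 s2] := ex (m - 1).
split=> [[a b] [a' b'] [/i1 aa' /i2 bb']|[a b]|[a b]].
- by congr pair; [exact: aa'|exact: bb'].
-
split=> [[/e1[u ua] /e2[v vb]]|[[u v] [<- <-]]].
    by exists (u, v); congr pair; [exact: ua|exact: vb].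
  by congr pair; [apply: exact_at_comp0 e1|apply: exact_at_comp0 e2].
- by have [u <-] := s1 a; have [v <-] := s2 b; exists (u, v).
Qed.

End Cone.

(** * Exactness of the modified tensor product with contractible complexes *)

Section ModifiedExactness.
Variable R : pzRingType.

Lemma mtens_pi_boundary (X : chain_complex R^c) (Y : chain_complex R) m t :
  mtens_pi (tot_diff t) = 0 :> mtens_obj X Y (m - 1).
Proof. exact/mtens_pi0/(@boundary_diff _ (totcx X Y)). Qed.

Fact tot_diff_boundary (X : chain_complex R^c) (Y : chain_complex R) m
    (t : tot_obj X Y m) :
  @boundary int (totcx X Y) m t -> tot_diff t = 0.
Proof. by case=> n [e [u]]; case: m / e t => t /= <-; exact: tot_diffK. Qed.

Lemma tot_diff_pi0 (X : chain_complex R^c) (Y : chain_complex R) m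
    (t : tot_obj X Y m) :
  mtens_pi t = 0 -> tot_diff t = 0.
Proof.
move=> t0; have <- := quot_lift_pi (f := @tot_diff R X Y m)
  (fun t => @tot_diff_boundary X Y m t) t.
by rewrite [quot_pi _ _]t0 linear0.
Qed.

(* When the total complex is exact, t |-> d t embeds the modified tensor
   product into the total complex. *)
Lemma mtens_pi_eq0 (X : chain_complex R^c) (Y : chain_complex R) m
    (t : tot_obj X Y m) :
  exact_complex (totcx X Y) -> mtens_pi t = 0 <-> tot_diff t = 0.
Proof.
move=> ex; split=> [|dt]; first exact: tot_diff_pi0.
(* Exactness speaks of degrees of the form [n - 1], so [m] is written [m + 1 - 1]. *)
rewrite -(addrK 1 m) in t dt *.
by have [u <-] := (ex _ _).1 dt; exact: mtens_pi_boundary.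
Qed.

(** Flatness of the terms of [P] makes the rows of total tensor products short exact in each degree.
    The contraction makes the total complexes themselves exact, which carries short exactness over
    to the quotients by boundaries. *)
Lemma contractible_flat (P : chain_complex R) r :
  @contraction R P r -> (forall m, flat_module (P m)) -> flat_complex P.
Proof.
move=> rP flatP X Y Z f g ex k.
have [? /contraction_exact exX] := tot_contractionr X rP.
have [? /contraction_exact exY] := tot_contractionr Y rP.
have [? /contraction_exact exZ] := tot_contractionr Z rP.
have fl m (p : tot_idx m) := flatP (val p).2 _ _ _ _ _ (ex (val p).1).
have inj m : injective (tot_map f (chain_id P) (m := m)).
  by apply: dsum_map_inj => p; case: (fl m p).
have mid m : exact_at (tot_map f (chain_id P) (m := m)) (tot_map g (chain_id P) (m := m)).
  by apply: dsum_map_exact => p; case: (fl m p).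
have sur m : forall v, exists u, tot_map g (chain_id P) (m := m) u = v.
  by apply: dsum_map_surj => p; case: (fl m p).
split=> /=.
(* Through the embedding given by the differential, injectivity in degree [k] is read off in degree
   [k - 1] of the total complexes. *)
- apply: linear_inj0; elim/quot_ind => t; rewrite /= -/(mtens_pi t) mtens_map_pi.
  move/(mtens_pi_eq0 _ exY); rewrite -tot_map_diff => ft0.
  apply/(mtens_pi_eq0 _ exX); apply: (inj (k - 1)).
  by rewrite ft0 linear0.
- move=> q; split=> [|[p <-]]; last first.
    elim/quot_ind: p => t; rewrite -/(mtens_pi t) !mtens_map_pi.
    by rewrite (exact_at_comp0 _ (mid k)) linear0.
  (* If the class of [g t] vanishes, [g t] is a boundary [d z]. With [z'] over [z], the element
     [t - d z'] has the class of [t] and lies in the kernel of [g], hence in the image of [f]. *)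
  elim/quot_ind: q => t; rewrite -/(mtens_pi t) mtens_map_pi => /(mtens_pi_eq0 _ exZ).
  rewrite -(addrK 1 k) in t *; move=> /(exZ _ _).1[z]; have [z' <-] := sur _ z.
  rewrite /= -tot_map_diff => gz.
  have /mid[u fu] : tot_map g (chain_id P) (t - tot_diff z') = 0.
    by rewrite linearB /= gz subrr.
  by exists (mtens_pi u); rewrite /= mtens_map_pi fu linearB /= mtens_pi_boundary subr0.
- elim/quot_ind => t; have [u <-] := sur k t; exists (mtens_pi u).
  by rewrite /= mtens_map_pi.
Qed.

(** If the class of [t] is killed, then [d t] is killed already in the total tensor product, so it
    comes from some [v]. The class of [h v] is the required preimage: by naturality [h v] maps to
    [h d t], and [d h d t = d t]. *)
Lemma contractible_mtens_exact (B : chain_complex R^c) s (F : complex_of_complexes R) :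
    @contraction R^c B s ->
    (forall m i j, exact_at (tens_map (idfun : {linear B i -> B i}) (cc_diff F m j))
                            (tens_map (idfun : {linear B i -> B i}) (cc_diff F (m - 1) j))) ->
  exact_cc (mtens_cc B F).
Proof.
move=> sB ex m k q; split=> [|[p <-]]; last exact: (cc_diffK (c := mtens_cc B F)).
have [h [hB hnat]] := tot_contractionl sB.
have exB Y := contraction_exact (hB Y).
elim/quot_ind: q => t; rewrite -/(mtens_pi t) /= mtens_map_pi => /(mtens_pi_eq0 _ (exB _)).
have mid n : exact_at (tot_map (chain_id B) (cc_diff F m) (m := n))
                      (tot_map (chain_id B) (cc_diff F (m - 1)) (m := n)).
  by apply: dsum_map_exact => p; apply: ex.
rewrite -tot_map_diff => /mid[v vt]; exists (mtens_pi (h _ _ v)).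
rewrite mtens_map_pi; apply/eqP; rewrite -subr_eq0 -linearB /=; apply/eqP.
apply/(mtens_pi_eq0 _ (exB _)); rewrite linearB -hnat vt /=; apply/eqP.
rewrite subr_eq0; apply/eqP; have := hB (F (m - 1)) k (tot_diff t).
by rewrite /= tot_diffK linear0 addr0.
Qed.

End ModifiedExactness.

(** * Terms of flat complexes *)

(* If M is a retract of a complex D along M -> D_0 -> D_(-1) -> M, then M (x) F_k
   is a retract of (D (x) F)_k, naturally in all the data. *)
Section TensorRetraction.
Variable R : pzRingType.

Definition deg0_idx (k : int) : tot_idx k := exist _ (0, k) (introT eqP (add0r k)).

Section Maps.
Variables (M : lmodType R^c) (D : chain_complex R^c) (F : chain_complex R) (k : int).

Definition mtens_in (e : {linear M -> D 0}) : {linear tens M (F k) -> mtens D F k} :=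
  @mtens_pi R D F k \o (dsum_in (A := @tot_comp R D F k) (i := deg0_idx k)
    \o tens_map e (idfun : {linear F k -> F k})).

Fact dsum_eval_linear (S : pzRingType) (I : choiceType) (A : I -> lmodType S) i :
  linear (fun u : dsum A => u i).
Proof. by []. Qed.

(** Applying the total differential first kills boundaries, so the map descends to the quotient;
    then the coordinate at [(-1, k)] is read off. *)
Definition mtens_out_pre (p : {linear D (0 - 1) -> M}) :
    {linear tot_obj D F k -> tens M (F k)} :=
  tens_map p (idfun : {linear F k -> F k}) \o
  (lin_of (dsum_eval_linear (A := @tot_comp R D F (k - 1)) (tot_idxl (deg0_idx k)))
   \o @tot_diff R D F k).

Fact mtens_out_boundary (p : {linear D (0 - 1) -> M}) t :
  @boundary int (totcx D F) k t -> mtens_out_pre p t = 0.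
Proof. by move=> /tot_diff_boundary bt; rewrite /mtens_out_pre /= bt !linear0. Qed.

Definition mtens_out (p : {linear D (0 - 1) -> M}) : {linear mtens D F k -> tens M (F k)} :=
  quot_lift (@mtens_out_boundary p).

Lemma mtens_outE (p : {linear D (0 - 1) -> M}) t : mtens_out p (mtens_pi t) = mtens_out_pre p t.
Proof. exact: quot_lift_pi. Qed.

Lemma mtens_inK (e : {linear M -> D 0}) (p : {linear D (0 - 1) -> M}) :
    (forall x, p (ch_diff D 0 (e x)) = x) ->
  cancel (mtens_in e) (mtens_out p).
Proof.
move=> epK t; pose h : {linear tens M (F k) -> tens M (F k)} := mtens_out p \o mtens_in e.
suff: forall t, h t = (idfun : {linear tens M (F k) -> _}) t by apply.
apply: tens_ext => x y.
have -> : h (pure x y) = mtens_out_pre p (tot_pure (p := deg0_idx k) (e x) y).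
  rewrite -mtens_outE /tot_pure -[pure (e x) y](tens_map_pure e idfun).
  by [].
(* Of the two summands of the differential only the one with [d (e x)] has index [(-1, k)]; the
   other one sits at [(0, k - 1)]. *)
have dE : tot_diff (tot_pure (p := deg0_idx k) (e x) y) (tot_idxl (deg0_idx k)) =
    pure (ch_diff D 0 (e x)) y :> tens (D (0 - 1)) (F k).
  rewrite tot_diff_pure dsumDE dsumZE /tot_pure /= dfwithin dfwithout ?scaler0 ?addr0 //.
by rewrite /mtens_out_pre /= /lin_of dE tens_map_pure epK.
Qed.

End Maps.

Lemma mtens_in_nat (M M' : lmodType R^c) (D D' : chain_complex R^c)
    (F F' : chain_complex R) k (e : {linear M -> D 0}) (e' : {linear M' -> D' 0})
    (f : {linear M -> M'}) (phi : chain_map D D') (g : chain_map F F') t :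
    (forall x, phi 0 (e x) = e' (f x)) ->
  mtens_map phi g k (mtens_in F k e t) = mtens_in F' k e' (tens_map f (g k) t).
Proof.
move=> phie; rewrite /mtens_in /= mtens_map_pi /tot_map; congr (mtens_pi _).
rewrite [dsum_map _ _]dsum_map_in; congr (dsum_in _).
exact: tens_map_square.
Qed.

Lemma mtens_out_nat (M M' : lmodType R^c) (D D' : chain_complex R^c)
    (F F' : chain_complex R) k (p : {linear D (0 - 1) -> M})
    (p' : {linear D' (0 - 1) -> M'})
    (f : {linear M -> M'}) (phi : chain_map D D') (g : chain_map F F') t :
    (forall x, p' (phi _ x) = f (p x)) ->
  mtens_out F' k p' (mtens_map phi g k t) = tens_map f (g k) (mtens_out F k p t).
Proof.
move=> phip; elim/quot_ind: t => t; rewrite -/(mtens_pi t).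
rewrite [mtens_map _ _ _ _]mtens_map_pi !mtens_outE.
rewrite /mtens_out_pre /= -tot_map_diff; exact: tens_map_square.
Qed.

Lemma exact_mtens_retract (M : lmodType R^c) (D : chain_complex R^c)
    (e : {linear M -> D 0}) (p : {linear D (0 - 1) -> M}) (F : complex_of_complexes R) :
    (forall x, p (ch_diff D 0 (e x)) = x) -> exact_cc (mtens_cc D F) ->
  forall m k, exact_at (tens_map (idfun : {linear M -> M}) (cc_diff F m k))
                       (tens_map (idfun : {linear M -> M}) (cc_diff F (m - 1) k)).
Proof.
move=> epK ex m k.
apply: (exact_at_retract (f' := cc_diff (mtens_cc D F) m k)
  (g' := cc_diff (mtens_cc D F) (m - 1) k)
  (iV := mtens_in _ _ e) (iW := mtens_in _ _ e) (rU := mtens_out _ _ p)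
  (rV := mtens_out _ _ p)) => [u||v|u||].
- rewrite (tens_map_comp (f := idfun) (g := \0)) //; first exact: tens_map0r.
  by move=> y; rewrite cc_diffK.
- exact: linear0.
- exact: mtens_in_nat.
- by rewrite (mtens_out_nat (f := idfun) (p := p)).
- exact: mtens_inK.
- exact: ex.
Qed.

(** The sequence [U -> V -> W] is a retract of the sequence of cones on constant families. Each
    module enters degree 0 as the second coordinate, which the differential moves to the first
    coordinate in degree -1. *)
Lemma flat_complex_component (F : chain_complex R) k : flat_complex F -> flat_module (F k).
Proof.
move=> flatF U V W f g ex.
have {}ex := flatF _ _ _ _ _ (cone_short_exact (fun=> ex)) k.
pose e (M : lmodType R^c) : {linear M -> cone (fun=> M) 0} :=
  pair_map \0 (idfun : {linear M -> M}).
pose p (M : lmodType R^c) : {linear cone (fun=> M) (0 - 1) -> M} := fst_map.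
have epK (M : lmodType R^c) (x : M) : p M (ch_diff (cone (fun=> M)) 0 (e M x)) = x by [].
apply: (short_exact_retract
  (iU := mtens_in F k (e U)) (iV := mtens_in F k (e V)) (iW := mtens_in F k (e W))
  (rU := mtens_out F k (p U)) (rV := mtens_out F k (p V)) (rW := mtens_out F k (p W))
  _ _ _ _ _ _ _ _ _ ex) => *; rewrite ?linear0 //; try exact: mtens_inK.
- by apply: mtens_in_nat => x; congr pair; exact: linear0.
- by apply: mtens_in_nat => x; congr pair; exact: linear0.
- by rewrite (mtens_out_nat (p := p U) (f := f)).
- by rewrite (mtens_out_nat (p := p V) (f := g)).
Qed.

End TensorRetraction.

(** Tensoring with [A * A'] is naturally the biproduct of tensoring with [A] and with [A'], so every
    condition is checked on the two summands. *)
Lemma flat_prod (R : pzRingType) (A A' : lmodType R) :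
  flat_module A -> flat_module A' -> flat_module (A * A')%type.
Proof.
move=> flA flA' U V W f g ex.
have [i1 e1 s1] := flA _ _ _ _ _ ex; have [i2 e2 s2] := flA' _ _ _ _ _ ex.
pose idM (M : lmodType R^c) := (idfun : {linear M -> M}).
pose p1 (M : lmodType R^c) : {linear tens M (A * A')%type -> _} := tens_map (idM M) fst_map.
pose p2 (M : lmodType R^c) : {linear tens M (A * A')%type -> _} := tens_map (idM M) snd_map.
pose j1 (M : lmodType R^c) : {linear _ -> tens M (A * A')%type} :=
  tens_map (idM M) (pair_map (idfun : {linear A -> A}) \0).
pose j2 (M : lmodType R^c) : {linear _ -> tens M (A * A')%type} :=
  tens_map (idM M) (pair_map \0 (idfun : {linear A' -> A'})).
have pj M t : t = j1 M (p1 M t) + j2 M (p2 M t).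
  elim/tens_ind: t => [x [a b]||t t' IH IH'|t IH]; rewrite ?linear0 ?addr0 //.
  - rewrite /p1 /p2 /j1 /j2 /= !tens_map_pure -pureDr; congr (pure _ _).
    by congr pair; rewrite ?addr0 ?add0r.
  - by rewrite !linearD addrACA -IH -IH'.
  - by rewrite !linearN -opprD -IH.
have pn1 (M N : lmodType R^c) (h : {linear M -> N}) t :
    p1 N (tens_map h idfun t) = tens_map h idfun (p1 M t).
  exact: tens_map_square.
have pn2 (M N : lmodType R^c) (h : {linear M -> N}) t :
    p2 N (tens_map h idfun t) = tens_map h idfun (p2 M t).
  exact: tens_map_square.
have jn1 (M N : lmodType R^c) (h : {linear M -> N}) t :
    j1 N (tens_map h idfun t) = tens_map h idfun (j1 M t).
  exact: tens_map_square.
have jn2 (M N : lmodType R^c) (h : {linear M -> N}) t :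
    j2 N (tens_map h idfun t) = tens_map h idfun (j2 M t).
  exact: tens_map_square.
split.
- apply: linear_inj0 => t ft0; rewrite [t]pj.
  have -> : p1 _ t = 0 by apply: i1; rewrite -pn1 ft0 !linear0.
  have -> : p2 _ t = 0 by apply: i2; rewrite -pn2 ft0 !linear0.
  by rewrite !linear0 addr0.
- move=> t; split=> [gt0|[u <-]]; last first.
    rewrite [tens_map g _ _]pj !pn1 !pn2 (exact_at_comp0 _ e1) (exact_at_comp0 _ e2).
    by rewrite !linear0 addr0.
  have /e1[u1 u1t] : tens_map g idfun (p1 _ t) = 0 by rewrite -pn1 gt0 linear0.
  have /e2[u2 u2t] : tens_map g idfun (p2 _ t) = 0 by rewrite -pn2 gt0 linear0.
  exists (j1 _ u1 + j2 _ u2).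
  by rewrite [RHS]pj -u1t -u2t jn1 jn2 -linearD.
- move=> t; have [v1 v1t] := s1 (p1 _ t); have [v2 v2t] := s2 (p2 _ t).
  exists (j1 _ v1 + j2 _ v2).
  by rewrite [RHS]pj -v1t -v2t jn1 jn2 -linearD.
Qed.

Lemma flat_cone (R : pzRingType) (A : int -> lmodType R) :
  (forall m, flat_module (A m)) -> flat_complex (cone A).
Proof.
move=> flatA; apply: contractible_flat (cone_contractionP (A := A)) _ => m.
exact: flat_prod.
Qed.

(** * Gorenstein flat modules *)

Section KernelsCokernels.
Variable S : pzRingType.

Lemma inj_surj_bij (U V : Type) (f : U -> V) :
  injective f -> (forall y, exists x, f x = y) -> bijective f.
Proof.
move=> inj sur; have fK y : f (sval (cid (sur y))) = y := svalP (cid (sur y)).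
by exists (fun y => sval (cid (sur y))) => // x; apply: inj.
Qed.

Lemma isomorphic_sym (U V : lmodType S) : isomorphic U V -> isomorphic V U.
Proof.
case=> f [g fK gK]; exists (lin_of (can2_linear fK gK)).
by exists f.
Qed.

Lemma isomorphic_trans (U V W : lmodType S) :
  isomorphic U V -> isomorphic V W -> isomorphic U W.
Proof. by case=> f bf [g bg]; exists (g \o f); exact: bij_comp. Qed.

Section KernelLift.
Variables (U V W : lmodType S) (f : {linear U -> V}) (g : {linear V -> W}).
Hypothesis gf : forall u, g (f u) = 0.

Fact ker_lift_subproof u : f u \in ker_pred g.
Proof. by rewrite inE gf. Qed.

Fact ker_lift_linear : linear (fun u => KerMod (ker_lift_subproof u)).
Proof. by move=> a u v; apply: val_inj; rewrite /= linearP. Qed.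

Definition ker_lift : {linear U -> kermod g} := lin_of ker_lift_linear.

Lemma ker_liftE u : val (ker_lift u) = f u.
Proof. by []. Qed.

Lemma ker_lift_surj : exact_at f g -> forall z, exists u, ker_lift u = z.
Proof.
move=> ex z; have /ex[u fu] : g (val z) = 0 by apply/eqP/(valP z).
by exists u; apply: val_inj; rewrite ker_liftE.
Qed.

Lemma ker_lift_inj : injective f -> injective ker_lift.
Proof. by move=> inj u v /(congr1 val) /= /inj. Qed.

End KernelLift.

Section Cokernel.
Variables (U V : lmodType S) (f : {linear U -> V}).

Definition coker : lmodType S := quotmod (fun v => exists u, f u = v).
Definition coker_pi : {linear V -> coker} := quot_pi (fun v => exists u, f u = v).

(** The cokernel divides by the span of the image; the image being a submodule, induction on the
    span recovers a preimage. *)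
Lemma coker_exact : exact_at f coker_pi.
Proof.
move=> v; split=> [v0|[u <-]]; last first.
  rewrite -[RHS](linear0 coker_pi); apply/quot_piE; rewrite subr0.
  by apply: span_gen; exists u.
have : coker_pi v = coker_pi 0 by rewrite linear0.
move/quot_piE; rewrite subr0; elim=> [|a x y [x' <-] _ [y' <-]].
  by exists 0; rewrite linear0.
by exists (a *: x' + y'); rewrite linearP.
Qed.

Lemma coker_surj q : exists v, coker_pi v = q.
Proof. by exists (quot_repr q); exact: quot_reprK. Qed.

Lemma coker_lift (W : lmodType S) (g : {linear V -> W}) :
  (forall u, g (f u) = 0) -> {h : {linear coker -> W} | forall v, h (coker_pi v) = g v}.
Proof.
move=> gf; have g0 v : (exists u, f u = v) -> g v = 0 by case=> u <-.
by exists (quot_lift g0) => v; exact: quot_lift_pi.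
Qed.

End Cokernel.

(** A surjection in front leaves the image unchanged, an injection behind leaves the kernel
    unchanged. *)
Lemma splice_exact (X U V W Y : lmodType S) (p : X -> U) (i : {linear U -> V})
    (q : {linear V -> W}) (j : {linear W -> Y}) :
    (forall u, exists x, p x = u) -> exact_at i q -> injective j ->
  exact_at (i \o p) (j \o q).
Proof.
move=> sp ex inj v; split=> [/= jq|[x <-]]; last first.
  by rewrite /= (exact_at_comp0 _ ex) linear0.
have /ex[u <-] : q v = 0 by apply: inj; rewrite jq linear0.
by have [x <-] := sp u; exists x.
Qed.

End KernelsCokernels.

(** * Single steps of Gorenstein flat resolutions *)

Section FlatSteps.
Variables (R : pzRingType) (BB : lmodType R^c -> Prop).

(** Tensoring being right exact, this is what keeps a short exact sequence starting with [i] exact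
    after tensoring with modules of [BB]. *)
Definition pure_for (U V : lmodType R) (i : {linear U -> V}) : Prop :=
  forall B : lmodType R^c, BB B -> injective (tens_map (idfun : {linear B -> B}) i).

(* A Gorenstein BB-flat module is one that can be continued in both directions
   by such steps M -> F -> N; a complex resolving it is spliced from them. *)
Definition flat_step (M N : lmodType R) : Prop :=
  exists (F : lmodType R) (i : {linear M -> F}) (p : {linear F -> N}),
    [/\ flat_module F, short_exact i p & pure_for i].

Lemma flat_step_sig (M N : lmodType R) : flat_step M N ->
  {F : lmodType R & {i : {linear M -> F} & {p : {linear F -> N} |
    [/\ flat_module F, short_exact i p & pure_for i]}}}.
Proof. by move=> /cid[F /cid[i /cid[p H]]]; exists F, i, p. Qed.

Lemma splice_tens_exact (B : lmodType R^c) (X U V W Y : lmodType R)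
    (p : {linear X -> U}) (i : {linear U -> V})
    (q : {linear V -> W}) (j : {linear W -> Y})
    (ip : {linear X -> V}) (jq : {linear V -> Y}) :
    BB B -> (forall x, i (p x) = ip x) -> (forall x, j (q x) = jq x) ->
    (forall u, exists x, p x = u) -> short_exact i q -> pure_for j ->
  exact_at (tens_map (idfun : {linear B -> B}) ip) (tens_map (idfun : {linear B -> B}) jq).
Proof.
move=> BBB ipE jqE sp [_ ex sq] inj t.
have ex' := splice_exact (tens_map_surj (M := B) sp)
  (tens_right_exact (B := B) ex sq) (inj B BBB).
have ipT := tens_map_comp (f := idfun)
  (f1 := idfun : {linear B -> B}) (f2 := idfun) (fun=> erefl) ipE.
have jqT := tens_map_comp (f := idfun)
  (f1 := idfun : {linear B -> B}) (f2 := idfun) (fun=> erefl) jqE.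
rewrite -jqT; split=> [/ex'[u <-]|[u <-]]; first by exists u; rewrite -ipT.
by rewrite -ipT; apply/ex'; exists u.
Qed.

Lemma flat_step_isol (M M' N : lmodType R) :
  isomorphic M M' -> flat_step M' N -> flat_step M N.
Proof.
move=> [f bf] [F [i [p [flatF [inj ex sur] pur]]]].
have [g fK gK] := bf; have finj := can_inj fK.
exists F, (i \o f), p; split=> //.
  split=> //; first exact: inj_comp.
  move=> y; split=> [/ex[x <-]|[x <-]]; first by exists (g x); rewrite /= gK.
  exact: exact_at_comp0 ex.
move=> B BBB; have iT := tens_map_comp (f := idfun) (g := i \o f)
  (f1 := idfun : {linear B -> B}) (f2 := idfun) (fun=> erefl) (fun=> erefl).
have gfT := tens_map_comp (f := idfun) (g := idfun) (g1 := f)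
  (g2 := lin_of (can2_linear fK gK))
  (f1 := idfun : {linear B -> B}) (f2 := idfun) (fun=> erefl) fK.
have idT (t : tens B M) : tens_map idfun idfun t = t by apply: tens_map_id.
move=> t u; rewrite -!iT => /(pur B BBB) tu.
by rewrite -[t]idT -[u]idT -!gfT tu.
Qed.

Lemma flat_step_isor (M N N' : lmodType R) :
  isomorphic N N' -> flat_step M N -> flat_step M N'.
Proof.
move=> [f [g fK gK]] [F [i [p [flatF [inj ex sur] pur]]]].
exists F, i, (f \o p); split=> //; split=> // y.
  split=> [/= fp|[x <-]]; last by rewrite /= (exact_at_comp0 _ ex) linear0.
  by apply/ex; apply: (can_inj fK); rewrite fp linear0.
by have [x px] := sur (g y); exists x; rewrite /= px gK.
Qed.

(** The differential is [F m -> Z (m - 1) -> F (m - 1)]; since its second factor is injective, its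
    kernel is the image of [Z m]. *)
Lemma gorenstein_flat_of_steps (Z : int -> lmodType R) :
  (forall m, flat_step (Z m) (Z (m - 1))) -> forall k, gorenstein_flat_module BB (Z k).
Proof.
(* The definition reads off cycles in degree 0, so the family is shifted by [k]. *)
suff H (Z' : int -> lmodType R) : (forall m, flat_step (Z' m) (Z' (m - 1))) ->
    gorenstein_flat_module BB (Z' 0).
  move=> steps k; have := H (fun m : int => Z (m + k)); rewrite add0r; apply=> m.
  by rewrite addrAC; exact: steps.
move=> steps; pose s m := flat_step_sig (steps m).
pose F m := projT1 (s m); pose i m : {linear Z' m -> F m} := projT1 (projT2 (s m)).
pose p m : {linear F m -> Z' (m - 1)} := sval (projT2 (projT2 (s m))).
have sP m : [/\ flat_module (F m), short_exact (i m) (p m) & pure_for (i m)].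
  exact: svalP (projT2 (projT2 (s m))).
have pi0 m x : p m (i m x) = 0 by case: (sP m) => _ [_ ex _] _; exact: exact_at_comp0 ex.
pose d m : {linear F m -> F (m - 1)} := i (m - 1) \o p m.
have dK m x : d (m - 1) (d m x) = 0 by rewrite /d /= pi0 linear0.
exists (ChainComplex dK); split=> [m|m|B BBB m|].
- have [_ [inj _ _] _] := sP (m - 1 - 1); have [_ [_ ex _] _] := sP (m - 1).
  by have [_ [_ _ sur] _] := sP m; apply: splice_exact.
- by case: (sP m).
- have [_ [_ _ sur] _] := sP m; have [_ ex _] := sP (m - 1).
  by have [_ _ inj] := sP (m - 1 - 1); apply: splice_tens_exact ex inj.
have [_ [inj ex _] _] := sP 0; have [_ [inj' _ _] _] := sP (0 - 1).
have di x : d 0 (i 0 x) = 0 by rewrite /d /= pi0 linear0.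
exists (ker_lift di); apply: inj_surj_bij; first exact: ker_lift_inj.
apply: ker_lift_surj => y; split=> [dy|[x <-]]; last exact: di.
by apply/ex; apply: inj'; rewrite linear0.
Qed.

Lemma steps_of_complex (F : chain_complex R) :
    exact_complex F -> (forall m, flat_module (F m)) ->
    (forall B : lmodType R^c, BB B -> exact_complex (tens_cx B F)) ->
  forall m, flat_step (cycles F m) (cycles F (m - 1)).
Proof.
move=> exF flatF tensF m.
(* In degrees of the form [k - 1 - 1] the incoming differentials land without casts. *)
suff H k : flat_step (cycles F (k - 1 - 1)) (cycles F (k - 1 - 1 - 1)).
  by have := H (m + 1 + 1); rewrite !addrK.
pose p l : {linear F l -> cycles F (l - 1)} := ker_lift (ch_diffK (c := F) (m := l)).
have ps l z : exists x, p l x = z by exact: ker_lift_surj.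
pose v l : {linear cycles F l -> F l} := val.
exists (F (k - 1 - 1)), (v _), (p _); split=> //.
  split=> // [y|]; last exact: ps.
  split=> [/(congr1 val) /= dy|[x <-]].
    have dy0 : y \in ker_pred (ch_diff F (k - 1 - 1)) by rewrite inE; apply/eqP.
    by exists (KerMod dy0).
  by apply: val_inj => /=; apply/eqP/(valP x).
(* Purity: [z] lifts to some [w] over [F (k - 1)]. If [z] dies in [B (x) F], then [w] is a cycle,
   hence a boundary, and boundaries vanish in the next module of cycles. *)
move=> B BBB; apply: linear_inj0 => z.
have [w <-] := tens_map_surj (M := B) (ps (k - 1)) z => vz.
have /(tensF B BBB k)[u <-] : ch_diff (tens_cx B F) (k - 1) w = 0.
  by rewrite -[RHS]vz; apply/esym; apply: tens_map_comp.
rewrite (tens_map_comp (f := idfun) (g := \0)) //; first exact: tens_map0r.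
by move=> y; apply: val_inj; rewrite /= ch_diffK.
Qed.

(** The neighbours of [M] are the cycles in degrees -1 and 1 of its resolution, and all cycles of
    that resolution are Gorenstein flat. *)
Lemma gorenstein_flat_steps (M : lmodType R) : gorenstein_flat_module BB M ->
  (exists2 N, gorenstein_flat_module BB N & flat_step M N) /\
  (exists2 N, gorenstein_flat_module BB N & flat_step N M).
Proof.
move=> [F [exF flatF tensF MF]]; have steps := steps_of_complex exF flatF tensF.
have GF := gorenstein_flat_of_steps steps.
split; [exists (cycles F (0 - 1))|exists (cycles F (0 + 1))] => //.
  exact: flat_step_isol MF (steps 0).
apply: flat_step_isor (isomorphic_sym MF) _.
by have := steps (0 + 1); rewrite addrK.
Qed.

(** The split step [A -> A * A -> A] can be repeated forever in both directions. *)
Lemma flat_gorenstein_flat (A : lmodType R) : flat_module A -> gorenstein_flat_module BB A.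
Proof.
move=> flatA; apply: (@gorenstein_flat_of_steps (fun=> A) _ 0) => _.
pose i : {linear A -> (A * A)%type} := pair_map (idfun : {linear A -> A}) \0.
exists (A * A)%type, i, snd_map; split.
- exact: flat_prod.
- split=> [a b /(congr1 fst) //|[a b]|b]; last by exists (0, b).
  by split=> [b0|[x <-]] //; exists a; congr pair; exact: esym b0.
- move=> B _; apply: (can_inj (g := tens_map idfun fst_map)) => t.
  by rewrite (tens_map_comp (f := idfun) (g := idfun)) //; exact: tens_map_id.
Qed.

End FlatSteps.

(** * Gorenstein flat complexes *)

(** A chain map out of the cone is free on the tops of the disks; on the bottoms it is forced to be
    [t (m - 1) = d q_m], which [unpred] turns into a family indexed by [m]. *)
Lemma cone_desc (S : pzRingType) (A : int -> lmodType S) (X : chain_complex S)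
    (q : forall m : int, {linear A (m - 1) -> X m}) :
  exists (f : chain_map (cone A) X) (t : forall m, {linear A m -> X m}),
    forall m (u : cone A m), f m u = q m u.2 + t m u.1.
Proof.
have [t tE] := unpred (T := fun m => {linear A m -> X m})
  (fun m => ch_diff X m \o q m).
pose f m : {linear cone A m -> X m} := (q m \o snd_map) \+ (t m \o fst_map).
have dt m a : ch_diff X m (t m a) = 0.
  by rewrite -(addrK 1 m) in a *; rewrite tE /= ch_diffK.
have fd m u : f (m - 1) (ch_diff (cone A) m u) = ch_diff X m (f m u).
  by rewrite /f /= /lin_of /= linear0 add0r linearD /= dt addr0 tE.
by exists (ChainMap fd), t.
Qed.

Section ComplexSteps.
Variables (R : pzRingType) (BB : lmodType R^c -> Prop).

(** Purity is asked degreewise and against modules: this is the form in which exactness after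
    tensoring with contractible complexes is checked. *)
Definition flat_step_cx (X Y : chain_complex R) : Prop :=
  exists (P : chain_complex R) (i : chain_map X P) (p : chain_map P Y),
    [/\ flat_complex P, short_exact_cx i p & forall m, pure_for BB (i m)].

Lemma flat_step_cx_sig (X Y : chain_complex R) : flat_step_cx X Y ->
  {P : chain_complex R & {i : chain_map X P & {p : chain_map P Y |
    [/\ flat_complex P, short_exact_cx i p & forall m, pure_for BB (i m)]}}}.
Proof. by move=> /cid[P /cid[i /cid[p H]]]; exists P, i, p. Qed.

Hypothesis BB_ext : closed_under_extensions (gorenstein_flat_module BB).

Let GFcx (X : chain_complex R) := forall m : int, gorenstein_flat_module BB (X m).

(** [X] embeds into a cone by [j], whose first coordinate is a step of each [X m]; its purity gives
    that of [j]. The cokernel of [j] is the new complex. *)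
Lemma flat_step_cx_right (X : chain_complex R) :
  GFcx X -> exists2 Y, GFcx Y & flat_step_cx X Y.
Proof.
move=> gfX.
have H m : {C : lmodType R & {F : lmodType R & {i : {linear X m -> F} & {p : {linear F -> C} |
  [/\ gorenstein_flat_module BB C, flat_module F, short_exact i p & pure_for BB i]}}}}.
  have [/cid2[C gfC /flat_step_sig[F [i [p [? ? ?]]]]] _] := gorenstein_flat_steps (gfX m).
  by exists C, F, i, p.
pose C m := projT1 (H m); pose A m := projT1 (projT2 (H m)).
pose i m : {linear X m -> A m} := projT1 (projT2 (projT2 (H m))).
pose p m : {linear A m -> C m} := sval (projT2 (projT2 (projT2 (H m)))).
have AP m : [/\ gorenstein_flat_module BB (C m), flat_module (A m),
    short_exact (i m) (p m) & pure_for BB (i m)].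
  exact: svalP (projT2 (projT2 (projT2 (H m)))).
(* The second coordinate is forced, as the differential of the cone moves it to the first. *)
pose j m : {linear X m -> cone A m} := pair_map (i m) (i (m - 1) \o ch_diff X m).
have jd m x : j (m - 1) (ch_diff X m x) = ch_diff (cone A) m (j m x).
  by congr pair; rewrite /= ch_diffK linear0.
have inj_i m : injective (i m) by case: (AP m) => _ _ [].
have inj_j m : injective (j m) by move=> x y [/inj_i].
pose d0 m : {linear cone A m -> coker (j (m - 1))} := coker_pi (j (m - 1)) \o ch_diff (cone A) m.
have d0j m x : d0 m (j m x) = 0.
  by rewrite /d0 /= -[X in quot_pi _ X](jd m); apply/coker_exact; eexists.
pose d m := coker_lift (d0j m).
have dE m u : sval (d m) (coker_pi (j m) u) = coker_pi (j (m - 1)) (ch_diff (cone A) m u).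
  by rewrite (svalP (d m)).
have dK m q : sval (d (m - 1)) (sval (d m) q) = 0.
  by have [u <-] := coker_surj q; rewrite !dE ch_diffK linear0.
exists (ChainComplex dK) => [m /=|]; last first.
  exists (cone A), (ChainMap jd).
  have pid m (u : cone A m) : coker_pi (j (m - 1)) (ch_diff (cone A) m u) =
    sval (d m) (coker_pi (j m) u) by rewrite dE.
  exists (@ChainMap _ (cone A) (ChainComplex dK) (fun m => coker_pi (j m)) pid); split.
  - by apply: flat_cone => m; case: (AP m).
  - by move=> m; split; [exact: inj_j|exact: coker_exact|exact: coker_surj].
  - move=> m B BBB t u tu; have [_ _ _ /(_ B BBB)] := AP m; apply.
    have jT := tens_map_comp (f := idfun) (g := i m) (g1 := j m) (g2 := fst_map)
      (f1 := idfun : {linear B -> B}) (f2 := idfun) (fun=> erefl) (fun=> erefl).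
    by rewrite -!jT tu.
(* The cokernel is an extension of [C m] by [A (m - 1)]: [k] includes the second coordinate, [r]
   applies [p m] to the first. *)
have [gfC _ [_ exip surp] _] := AP m; have [_ flatA _ _] := AP (m - 1).
pose k : {linear A (m - 1) -> coker (j m)} :=
  coker_pi (j m) \o pair_map \0 (idfun : {linear A (m - 1) -> _}).
pose r0 : {linear cone A m -> C m} := p m \o fst_map.
have r0j x : r0 (j m x) = 0 by rewrite /r0 /=; apply: exact_at_comp0 exip.
have [r rE] := coker_lift r0j.
apply: (BB_ext (f := k) (g := r)) (flat_gorenstein_flat _ flatA) gfC; split.
- apply: linear_inj0 => b /coker_exact[x [ix <-]].
  have -> : x = 0 by apply: inj_i; rewrite linear0 -[RHS]ix.
  by rewrite !linear0.
- move=> q; split=> [|[b <-]]; last by rewrite /k /= rE /r0 /= linear0.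
  (* If [p a = 0] then [a = i x], and subtracting [j x] from [(a, b)] clears the first
     coordinate. *)
  have [[a b] <-] := coker_surj q; rewrite rE => /exip[x ix].
  set z := i (m - 1) (ch_diff X m x); exists (b - z).
  change (coker_pi (j m) (0, b - z) = coker_pi (j m) (a, b)).
  apply/eqP; rewrite -subr_eq0 -linearB; apply/eqP/coker_exact.
  exists (- x); rewrite linearN; congr pair => /=.
    by rewrite sub0r; congr (- _).
  by rewrite addrAC subrr sub0r.
- move=> c; have [a <-] := surp c; exists (coker_pi (j m) (a, 0)).
  by rewrite rE.
Qed.

(** A cone on flat modules maps onto [X] by steps ending at each [X m]; the kernel is an extension
    of [A m] by [K m], and is the new complex. *)
Lemma flat_step_cx_left (X : chain_complex R) :
  GFcx X -> exists2 Y, GFcx Y & flat_step_cx Y X.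
Proof.
move=> gfX.
pose good (m : int) (A : lmodType R) :=
  exists (K : lmodType R) (j : {linear K -> A}) (q : {linear A -> X m}),
  [/\ gorenstein_flat_module BB K, flat_module A, short_exact j q & pure_for BB j].
have H m : {A : lmodType R | good m A}.
  have [_ /cid2[K gfK /flat_step_sig[F [i [p [? ? ?]]]]]] := gorenstein_flat_steps (gfX m).
  by exists F, K, i, p.
(* The flat module over [X m] must be the top of a disk in degree [m], so it is indexed as
   [A (m - 1)]. *)
have [A AE] := unpred (T := fun=> lmodType R) (fun m => sval (H m)).
have {AE}H m : {K : lmodType R & {j : {linear K -> A (m - 1)} & {q : {linear A (m - 1) -> X m} |
  [/\ gorenstein_flat_module BB K, flat_module (A (m - 1)), short_exact j q & pure_for BB j]}}}.
  by have := svalP (H m); rewrite -AE => /cid[K /cid[j /cid[q Hq]]]; exists K, j, q.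
pose K m := projT1 (H m); pose j m : {linear K m -> A (m - 1)} := projT1 (projT2 (H m)).
pose q m : {linear A (m - 1) -> X m} := sval (projT2 (projT2 (H m))).
have AP m : [/\ gorenstein_flat_module BB (K m), flat_module (A (m - 1)),
    short_exact (j m) (q m) & pure_for BB (j m)].
  exact: svalP (projT2 (projT2 (H m))).
have flatA m : flat_module (A m) by have [_ fA _ _] := AP (m + 1); rewrite addrK in fA.
have [f [t fE]] := cone_desc q.
have k0 m x : f m (0, j m x) = 0.
  by case: (AP m) => _ _ [_ ex _] _; rewrite fE /= linear0 addr0 (exact_at_comp0 _ ex).
have kl m x : f m (pair_map \0 (j m) x) = 0 by exact: k0.
pose k m : {linear K m -> kermod (f m)} := ker_lift (kl m).
pose v m : {linear kermod (f m) -> cone A m} := val.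
pose g m : {linear kermod (f m) -> A m} := fst_map \o v m.
have exkg m : short_exact (k m) (g m).
  case: (AP m) => _ _ [inj ex sur] _; split.
  - by move=> x y /(congr1 val) [/inj].
  - move=> y; split=> [|[x <-] //].
    have /eqP := valP y; case yE: (val y) => [a b] fy; rewrite /g /= [ker_val y]yE => a0.
    have {}a0 : a = 0 by [].
    rewrite fE /= a0 linear0 addr0 in fy; have [x jx] := (ex b).1 fy.
    by exists x; apply: val_inj; rewrite /= yE a0 -jx.
  (* The second coordinate is chosen to cancel the contribution [t a] of the first. *)
  - move=> a; have [b qb] := sur (- t m a).
    have fab : (a, b) \in ker_pred (f m) by rewrite inE fE /= qb addNr.
    by exists (KerMod fab).
exists (kercx f) => [m|].
  have [gfK _ _ _] := AP m.
  exact: BB_ext (exkg m) gfK (flat_gorenstein_flat _ (flatA m)).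
have vd m (x : kercx f m) : v (m - 1) (ch_diff (kercx f) m x) = ch_diff (cone A) m (v m x) by [].
exists (cone A), (@ChainMap _ (kercx f) (cone A) v vd), f; split.
- exact: flat_cone.
- move=> m; split=> [x y xy|y|x]; first exact: val_inj.
    split=> [/eqP fy|[x <-]]; last exact/eqP/(valP x).
    have fy' : y \in ker_pred (f m) by rewrite inE.
    by exists (KerMod fy').
  have [_ _ [_ _ sur] _] := AP m; have [b <-] := sur x; exists (0, b).
  by rewrite fE /= linear0 addr0.
(* If [z] dies in the cone, its first coordinate vanishes, so [z] comes from some [z'] over [K m].
   Its second coordinate is then the image of [z'] under the pure map [j], so [z'] is 0. *)
- move=> m B BBB; apply: linear_inj0 => z vz0.
  have [_ _ [_ ex _] /(_ B BBB) inj] := AP m; have [_ exk surg] := exkg m.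
  have /(tens_right_exact (B := B) exk surg)[z' zE] :
      tens_map (idfun : {linear B -> B}) (g m) z = 0.
    rewrite -(tens_map_comp (f1 := idfun) (f2 := idfun) (g1 := v m) (g2 := fst_map)) //.
    by rewrite vz0 linear0.
  rewrite -zE; suff -> : z' = 0 by rewrite linear0.
  apply: inj; rewrite linear0.
  rewrite -(tens_map_comp (f1 := idfun) (f2 := idfun) (g1 := k m) (g2 := snd_map \o v m)) //.
  rewrite zE -(tens_map_comp (f1 := idfun) (f2 := idfun) (g1 := v m) (g2 := snd_map)) //.
  by rewrite vz0 linear0.
Qed.

Section Characterization.
Variable BH : chain_complex R^c -> Prop.

(** The class of complexes enters only through this and the two hypotheses below, so that sums of
    disks and injective complexes are treated together. *)
Hypothesis BH_retract : forall M : lmodType R^c, BB M ->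
  exists (D : chain_complex R^c) (e : {linear M -> D 0}) (p : {linear D (0 - 1) -> M}),
    BH D /\ forall x, p (ch_diff D 0 (e x)) = x.

Lemma gorenstein_flat_component (X : chain_complex R) :
  gorenstein_flat_complex BH X -> GFcx X.
Proof.
move=> [F [exF flatF tensF [f bf]]] k.
pose Fk := @ChainComplex _ (fun m => F m k) (fun m => cc_diff F m k)
  (fun m x => cc_diffK x).
exists Fk; split=> [m|m|B /BH_retract[D [e [p [BHD ep]]]] m|].
- exact: exF.
- exact: (@flat_complex_component _ (F m) k).
- exact: exact_mtens_retract ep (tensF D BHD) m k.
- by exists (f k); exact: bf k.
Qed.

Hypothesis BH_contractible : forall D, BH D -> exists s, @contraction R^c D s.
Hypothesis BH_component : forall D i, BH D ->
  forall (U V W : lmodType R) (f : {linear U -> V}) (g : {linear V -> W}),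
    (forall M : lmodType R^c, BB M -> exact_at (tens_map (idfun : {linear M -> M}) f)
                              (tens_map (idfun : {linear M -> M}) g)) ->
    exact_at (tens_map (idfun : {linear D i -> D i}) f)
             (tens_map (idfun : {linear D i -> D i}) g).

Lemma gorenstein_flat_of_components (X : chain_complex R) :
  GFcx X -> gorenstein_flat_complex BH X.
Proof.
move=> gfX.
have [Z Z0 ZP] := int_chain gfX flat_step_cx_right flat_step_cx_left.
pose s m := flat_step_cx_sig (ZP m).2.
pose F m := projT1 (s m); pose i m : chain_map (Z m) (F m) := projT1 (projT2 (s m)).
pose p m : chain_map (F m) (Z (m - 1)) := sval (projT2 (projT2 (s m))).
have sP m : [/\ flat_complex (F m), short_exact_cx (i m) (p m) &
    forall k, pure_for BB (i m k)].
  exact: svalP (projT2 (projT2 (s m))).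
have pi0 m k x : p m k (i m k x) = 0.
  by case: (sP m) => _ ex _; case: (ex k) => _ {}ex _; exact: exact_at_comp0 ex.
pose d m k : {linear F m k -> F (m - 1) k} := i (m - 1) k \o p m k.
have dC m k x : d m (k - 1) (ch_diff (F m) k x) = ch_diff (F (m - 1)) k (d m k x).
  by rewrite /d /= !cm_comm.
have dK m k x : d (m - 1) k (d m k x) = 0 by rewrite /d /= pi0 linear0.
pose FF := @ComplexOfComplexes _ F (fun m => ChainMap (dC m)) dK.
exists FF; split=> [m k|m|B BHB|].
- have [_ /(_ k)[inj _ _] _] := sP (m - 1 - 1); have [_ /(_ k)[_ ex _] _] := sP (m - 1).
  by have [_ /(_ k)[_ _ sur] _] := sP m; apply: splice_exact.
- by case: (sP m).
- have [c cP] := BH_contractible BHB; apply: contractible_mtens_exact cP _ => m l k.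
  apply: BH_component => // M BBM.
  have [_ /(_ k)[_ _ sur] _] := sP m; have [_ /(_ k) ex _] := sP (m - 1).
  by have [_ _ /(_ k) inj] := sP (m - 1 - 1); apply: splice_tens_exact ex inj.
have di k x : d 0 k (i 0 k x) = 0 by rewrite /d /= pi0 linear0.
pose l k : {linear Z 0 k -> kermod (d 0 k)} := ker_lift (di k).
have lC k x : l (k - 1) (ch_diff (Z 0) k x) = ch_diff (cycles_cc FF 0) k (l k x).
  by apply: val_inj; exact: cm_comm.
rewrite -Z0; exists (@ChainMap _ (Z 0) (cycles_cc FF 0) l lC) => k /=.
 have [_ /(_ k)[inj ex _] _] := sP 0; have [_ /(_ k)[inj' _ _] _] := sP (0 - 1).
apply: inj_surj_bij; first exact: ker_lift_inj.
apply: ker_lift_surj => y; split=> [dy|[x <-]]; last exact: di.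
by apply/ex; apply: inj'; rewrite linear0.
Qed.

End Characterization.
End ComplexSteps.

(** * Sums of disks and injective complexes *)

Lemma contraction_retract (S : pzRingType) (D P : chain_complex S) r
    (f : chain_map D P) (g : chain_map P D) :
  @contraction S P r -> (forall m, cancel (f m) (g m)) -> exists s, @contraction S D s.
Proof.
move=> rP fK; exists (fun m => g m \o (r m \o f (m - 1))) => m x.
by rewrite /= -!cm_comm -linearD cm_comm rP fK.
Qed.

Lemma tens_retract_exact (R : pzRingType) (M M' : lmodType R^c)
    (i : {linear M -> M'}) (r : {linear M' -> M})
    (U V W : lmodType R) (f : {linear U -> V}) (g : {linear V -> W}) :
    cancel i r ->
    exact_at (tens_map (idfun : {linear M' -> M'}) f)
             (tens_map (idfun : {linear M' -> M'}) g) ->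
  exact_at (tens_map (idfun : {linear M -> M}) f)
           (tens_map (idfun : {linear M -> M}) g).
Proof.
move=> iK ex; pose I (N : lmodType R) := tens_map i (idfun : {linear N -> N}).
pose r' (N : lmodType R) := tens_map r (idfun : {linear N -> N}).
have rI (N : lmodType R) (t : tens M N) : r' N (I N t) = t.
  by rewrite /r' /I (tens_map_comp (f := idfun) (g := idfun)) //; exact: tens_map_id.
have In (N N' : lmodType R) (h : {linear N -> N'}) t :
    tens_map idfun h (I N t) = I N' (tens_map idfun h t).
  exact: tens_map_square.
have rn (N N' : lmodType R) (h : {linear N -> N'}) t :
    tens_map idfun h (r' N t) = r' N' (tens_map idfun h t).
  exact: tens_map_square.
apply: (exact_at_retract _ _ (In V W g) (rn U V f) (rI V) ex); last exact: linear0.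
by move=> u; rewrite -[u]rI !rn (exact_at_comp0 _ ex) /r' linear0.
Qed.

Lemma isomorphic_cx_retract (S : pzRingType) (X Y : chain_complex S) :
  isomorphic_cx X Y ->
  exists (f : chain_map X Y) (g : chain_map Y X), forall m, cancel (f m) (g m).
Proof.
case=> f bf; have H m : exists g : {linear Y m -> X m}, cancel (f m) g /\ cancel g (f m).
  by have [g fK gK] := bf m; exists (lin_of (can2_linear fK gK)).
pose g m := sval (cid (H m)); have gP m := svalP (cid (H m)).
have gd m y : g (m - 1) (ch_diff Y m y) = ch_diff X m (g m y).
  apply: (can_inj (gP (m - 1)).1); rewrite (gP (m - 1)).2 cm_comm.
  by rewrite (gP m).2.
by exists f, (ChainMap gd) => m; case: (gP m).
Qed.

Section SumsOfDisks.

(** Either [b] is false and the module is zero, or both booleans are true and all maps are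
    identities. *)
Lemma only_inK (S : pzRingType) (M : lmodType S) (b b' : bool) (x : only_if M b) : (b -> b') ->
  only_in M b (only_out M b' (only_in M b' (only_out M b x))) = x.
Proof. case: b x => x bb'; last by rewrite [LHS]thinmx0 [RHS]thinmx0.
by case: b' bb' => // /(_ isT). Qed.

Lemma disk_contractible (S : pzRingType) (M : lmodType S) (m : int) :
  exists r, @contraction S (disk M m) r.
Proof.
pose r (n : int) : {linear disk M m (n - 1) -> disk M m n} :=
  if n == m then (only_in M _ \o only_out M _ : {linear disk_obj M m (n - 1) -> disk_obj M m n})
  else \0.
have d1 n : n = m -> disk_diff M m n = (only_in M _ \o only_out M _).
  by move/eqP=> nm; rewrite /disk_diff ifT.
have d0 n : n != m -> disk_diff M m n = \0 by move=> nm; rewrite /disk_diff ifN.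
have r1 n : n = m -> r n = (only_in M _ \o only_out M _).
  by move/eqP=> nm; rewrite /r ifT.
have r0 n : n != m -> r n = \0 by move=> nm; rewrite /r ifN.
exists r => n x; change (disk_diff M m n (r n x) + r (n - 1) (disk_diff M m (n - 1) x) = x).
(* The identity holds in degree [m - 1] by [d r], in degree [m] by [r d], and elsewhere because the
   module is zero. *)
have [nm|nm] := eqVneq n m.
  have nm' : n - 1 != m by rewrite nm -subr_eq0 addrAC subrr sub0r oppr_eq0.
  rewrite (d1 n nm) (r1 n nm) (d0 _ nm') linear0 addr0; apply: only_inK.
  by move=> _; rewrite nm eqxx.
have [nm'|nm'] := eqVneq (n - 1) m.
  rewrite (r0 n nm) linear0 add0r (d1 _ nm') (r1 _ nm'); apply: only_inK.
  by move=> _; rewrite nm' eqxx orbT.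
rewrite (r0 n nm) (r0 _ nm') linear0 addr0.
have b0 : (n - 1 == m) || (n - 1 == m - 1) = false.
  by rewrite (negPf nm') (inj_eq (addIr _)) (negPf nm).
by move: x; rewrite /= /disk_obj b0 => x; rewrite [LHS]thinmx0 [RHS]thinmx0.
Qed.

Variables (R : pzRingType) (BB : lmodType R^c -> Prop).

Lemma sums_of_disks_retract (M : lmodType R^c) : BB M ->
  exists (D : chain_complex R^c) (e : {linear M -> D 0}) (p : {linear D (0 - 1) -> M}),
    sums_of_disks BB D /\ forall x, p (ch_diff D 0 (e x)) = x.
Proof.
(* A sum of disks needs a member of [BB] in every degree and [BB] may miss the zero module, so [M]
   is used throughout; the retraction lives on the summand of index 0. *)
move=> BBM; pose D := dsumcx (fun n : int => disk M n).
pose e1 : {linear disk M 0 0 -> D 0} :=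
  (@dsum_in R^c int (fun n : int => disk M n 0) 0 : {linear _ -> _}).
pose e : {linear M -> D 0} := e1 \o (only_in M _ : {linear M -> disk M 0 0}).
pose p : {linear D (0 - 1) -> M} :=
  (only_out M _ : {linear disk M 0 (0 - 1) -> M}) \o
  lin_of (dsum_eval_linear (A := fun n : int => disk M n (0 - 1)) 0).
exists D, e, p; split.
  exists (fun=> M); split=> //; exists (chain_id D) => m.
  by exists idfun.
by move=> x; rewrite /e /p /= [dsum_map _ _]dsum_map_in /lin_of /= dfwithin.
Qed.

Lemma sums_of_disks_contractible (D : chain_complex R^c) :
  sums_of_disks BB D -> exists s, @contraction R^c D s.
Proof.
move=> [B [_ /isomorphic_cx_retract[f [g fK]]]].
pose r n := sval (cid (disk_contractible (B n) n)).
have rP n : contraction (r n) := svalP (cid (disk_contractible (B n) n)).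
pose P := dsumcx (fun n => disk (B n) n).
pose s m : {linear P (m - 1) -> P m} := dsum_map (fun n => r n m).
have sP : contraction s by move=> m x; apply: dsumP => n; exact: rP.
exact: contraction_retract sP fK.
Qed.

Lemma sums_of_disks_component (D : chain_complex R^c) i : sums_of_disks BB D ->
  forall (U V W : lmodType R) (f : {linear U -> V}) (g : {linear V -> W}),
    (forall M : lmodType R^c, BB M -> exact_at (tens_map (idfun : {linear M -> M}) f)
                              (tens_map (idfun : {linear M -> M}) g)) ->
    exact_at (tens_map (idfun : {linear D i -> D i}) f)
             (tens_map (idfun : {linear D i -> D i}) g).
Proof.
move=> [B [BBB /isomorphic_cx_retract[a [b aK]]]] U V W f g ex.
apply: tens_retract_exact (aK i) _; apply: tens_dsum_exact => n /=.
rewrite /disk_obj; case: (_ || _) => /=; first exact: ex.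
have tens0 (N : lmodType R) (t : tens ('rV[R^c]_0 : lmodType R^c) N) : t = 0.
  elim/tens_ind: t => [x y||t u -> ->|t ->]; rewrite ?addr0 ?oppr0 //.
  by rewrite [x]thinmx0 pure0l.
by move=> t; split=> _; [exists 0; rewrite linear0 [RHS]tens0|exact: tens0].
Qed.

End SumsOfDisks.

(** * Injective complexes and their terms *)

Section InjectiveComplexes.
Variable S : pzRingType.

(** A chain map into a cone amounts to an arbitrary family of first coordinates, and these extend
    degree by degree. *)
Lemma cone_injective (M : lmodType S) :
  injective_module M -> injective_complex (cone (fun=> M)).
Proof.
move=> injM X Y f g inj.
have H m : {b : {linear Y m -> M} | forall x, b (f m x) = (g m x).1}.
  exact/cid/(injM _ _ (f m) (fst_map \o g m)).
pose b m := sval (H m); have bf m x : b m (f m x) = (g m x).1 := svalP (H m) x.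
pose h m : {linear Y m -> cone (fun=> M) m} := pair_map (b m) (b (m - 1) \o ch_diff Y m).
have hd m y : h (m - 1) (ch_diff Y m y) = ch_diff (cone (fun=> M)) m (h m y).
  by congr pair; rewrite /= ch_diffK linear0.
exists (ChainMap hd) => m x; rewrite [RHS]surjective_pairing; congr pair; first exact: bf.
by rewrite /= -cm_comm bf cm_comm.
Qed.

(** The embedding [x |-> (x, d x)] into the contractible cone on the terms of [I] splits by
    injectivity. *)
Lemma injective_complex_contractible (I : chain_complex S) :
  injective_complex I -> exists s, @contraction S I s.
Proof.
move=> injI.
pose f m : {linear I m -> cone I m} := pair_map (idfun : {linear I m -> I m}) (ch_diff I m).
have fd m x : f (m - 1) (ch_diff I m x) = ch_diff (cone I) m (f m x).
  by congr pair; exact: ch_diffK.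
have [|g gf] := injI I (cone I) (ChainMap fd) (chain_id I).
  by move=> m x y [].
exact: (contraction_retract (f := ChainMap fd) (g := g) (cone_contractionP (A := I))).
Qed.

(* A map U -> I_k extends to a map of complexes from the sum of all disks on U,
   zero on the disks other than D^k(U). *)
Lemma injective_complex_component (I : chain_complex S) k :
  injective_complex I -> injective_module (I k).
Proof.
move=> injI U V f g inj.
have [a [t aE]] := cone_desc (A := fun=> U) (X := I)
  (dfwith (fun m => \0 : {linear U -> I m}) k g).
have [|h hE] := injI _ _ (cone_map (fun=> f)) a.
  by move=> m [x y] [x' y'] [/inj xx' /inj yy']; congr pair; [exact: xx'|exact: yy'].
exists (h k \o pair_map \0 (idfun : {linear V -> V})) => x.
have := hE k (0, x); rewrite aE /= linear0 addr0 dfwithin => <-.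
by congr (h k (_, _)); rewrite /= linear0.
Qed.

End InjectiveComplexes.

Theorem proposition2p23 (R : pzRingType) (BB : lmodType R^c -> Prop)
  (BB_ext : closed_under_extensions (gorenstein_flat_module BB)) :
  (forall X : chain_complex R,
     gorenstein_flat_complex (sums_of_disks BB) X <->
     (forall m : int, gorenstein_flat_module BB (X m))) /\
  ((forall E : lmodType R^c, BB E <-> injective_module E) ->
   forall X : chain_complex R,
     gorenstein_flat_complex (@injective_complex R^c) X <->
     (forall m : int, gorenstein_flat_module (@injective_module R^c) (X m))).
Proof.
split=> [X|BBE X].
  split; first exact/gorenstein_flat_component/sums_of_disks_retract.
  apply: gorenstein_flat_of_components => //.
  - exact: sums_of_disks_contractible.
  - exact: sums_of_disks_component.
(* As predicates the two classes are equal, so closure under extensions, assumed for [BB], holds for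
   injective modules. *)
have {BBE}BBE : BB = @injective_module R^c by apply/funext => E; apply/propext.
rewrite -{1}BBE in BB_ext *; rewrite {}BBE in BB_ext *; split.
  apply: gorenstein_flat_component => M injM.
  exists (cone (fun=> M)), (pair_map \0 (idfun : {linear M -> M})), fst_map.
  by split=> //; exact: cone_injective.
apply: gorenstein_flat_of_components => // [D|D i /injective_complex_component injD U V W f g].
  exact: injective_complex_contractible.
by apply; exact: injD.
Qed.
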